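(* Assume $0<\bar\theta<\pi/2$. Let $\Pi_1$ be the orthogonal projection of $\mathbb{R}^2$ onto the line $\{x_1=0\}$ and let $\Pi_2$ be the orthogonal projection onto the line $\{x_1\cos\bar\theta+x_2\sin\bar\theta=0\}$. As $k\to\infty$, the solutions $u_k$ of the penalized problem converge uniformly on compact subsets of $\mathbb{R}^+=[0,\infty)$ to the function $u_\infty$ given by $$u_\infty(t)=\begin{cases} u(0)+t\,\Pi_1\dot u(0) & \text{if } 0\le t\le t_0,\\ (t-t_0)\,\Pi_2\Pi_1\dot u(0) & \text{if } t_0\le t,\end{cases}$$ where $u(0)=(0,x_2(0))^T$, $\dot u(0)=(\dot x_1(0),\dot x_2(0))^T$ and $t_0=-x_2(0)/\dot x_2(0)$.
   Context: Fix $\bar\theta\in(0,\pi)$ and let $K=\{(x_1,x_2)\in\mathbb{R}^2: x_1\le 0 \text{ and } x_1\cos\bar\theta+x_2\sin\bar\theta\le 0\}$, a closed convex cone; $P_K$ is the projection onto $K$ (nearest point map). For $u,v\in\mathbb{R}^2$ put $$G(u,v)=\frac{\bigl(v\cdot(u-P_Ku)\bigr)(u-P_Ku)}{|u-P_Ku|^2}\ \text{ if } u\notin K,\qquad G(u,v)=0\ \text{ if } u\in K.$$ Fix $\alpha>1$ and real numbers $x_2(0)<0$, $\dot x_1(0)>0$, $\dot x_2(0)>0$, all independent of $k$. For $k>0$, $u_k:[0,\infty)\to\mathbb{R}^2$ is the ($C^1$) solution of the penalized problem $$\ddot u_k+2\alpha\sqrt k\,G(u_k,\dot u_k)+k(u_k-P_Ku_k)=0\quad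 (t>0),$$ $$u_k(0)=(0,x_2(0))^T,\qquad \dot u_k(0)=(\dot x_1(0),\dot x_2(0))^T.$$ *)

(* Defs.v *)
From HB Require Import structures.
From mathcomp Require Import all_boot all_order all_algebra.
From mathcomp Require Import all_classical all_reals all_analysis.

Set Implicit Arguments.
Unset Strict Implicit.
Unset Printing Implicit Defensive.

Import Order.TTheory GRing.Theory Num.Theory.
Import numFieldNormedType.Exports.

Local Open Scope classical_set_scope.
Local Open Scope ring_scope.

Definition vec2 (R : realType) (a b : R) : 'rV[R]_2 :=
  \row_(i < 2) (if i == 0 then a else b).

(* The library norm `|u| on 'rV[R]_2 is the sup norm, so the Euclidean
   structure has to be introduced separately. *)
Definition dot (R : realType) (u v : 'rV[R]_2) : R :=
  \sum_(i < 2) u 0 i * v 0 i.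

Definition enorm (R : realType) (u : 'rV[R]_2) : R := Num.sqrt (dot u u).

(* Unique whenever A is nonempty, closed and convex. *)
Definition nearest_point (R : realType) (A : set 'rV[R]_2) (u : 'rV[R]_2) :
    'rV[R]_2 :=
  xget 0 [set p | A p /\ forall q, A q -> enorm (u - p) <= enorm (u - q)].

(* L is meant to be a linear subspace. *)
Definition orth_proj (R : realType) (L : set 'rV[R]_2) (u : 'rV[R]_2) :
    'rV[R]_2 :=
  xget 0 [set p | L p /\ forall q, L q -> dot (u - p) q = 0].

Definition coneK (R : realType) (theta : R) : set 'rV[R]_2 :=
  [set x | x 0 0 <= 0 /\ x 0 0 * cos theta + x 0 1 * sin theta <= 0].

Definition line1 (R : realType) : set 'rV[R]_2 := [set x | x 0 0 = 0].

Definition line2 (R : realType) (theta : R) : set 'rV[R]_2 :=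
  [set x | x 0 0 * cos theta + x 0 1 * sin theta = 0].

Definition projK (R : realType) (theta : R) (u : 'rV[R]_2) : 'rV[R]_2 :=
  nearest_point (coneK theta) u.

Definition damping (R : realType) (theta : R) (u v : 'rV[R]_2) : 'rV[R]_2 :=
  let w := u - projK theta u in
  if u \in coneK theta then 0 else (dot v w / enorm w ^+ 2) *: w.

(* f is differentiable at t relatively to D, with derivative l; at an end point
   of an interval D this is the one-sided derivative. *)
Definition has_derivative_within (R : realType) (D : set R)
    (f : R -> 'rV[R]_2) (t : R) (l : 'rV[R]_2) : Prop :=
  (s - t)^-1 *: (f s - f t) @[s --> within D t^'] --> l.

(* u is C^1 on [0, +oo[ with derivative v. *)
Definition C1_with_velocity (R : realType) (u v : R -> 'rV[R]_2) : Prop :=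
  (forall t, 0 <= t -> has_derivative_within `[0, +oo[ u t (v t)) /\
  {within `[0, +oo[, continuous v}.

(* Since damping jumps across the boundary of the cone, a C^1 solution has in
   general no second derivative at the times where it crosses that boundary, so
   the equation is required at almost every t > 0 (Caratheodory solution).
   The Lipschitz condition excludes singular velocities; as
   enorm (damping theta u v) <= enorm v, it holds for every C^1 function u with
   an absolutely continuous velocity solving the equation almost everywhere, and
   for every C^1 function u solving the equation at all t > 0. *)
Definition penalized_solution (R : realType) (theta alpha k : R)
    (u0 v0 : 'rV[R]_2) (u : R -> 'rV[R]_2) : Prop :=
  exists v : R -> 'rV[R]_2,
    [/\ C1_with_velocity u v,
        forall T : R, 0 < T -> [lipschitz v t | t in `[0, T]],
        \forall t \ae (@lebesgue_measure R), 0 < t ->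
          derivable v t 1 /\
          'D_1 v t + (2 * alpha * Num.sqrt k) *: damping theta (u t) (v t)
            + k *: (u t - projK theta (u t)) = 0,
        u 0 = u0
      & v 0 = v0].

Definition limit_motion (R : realType) (theta : R) (u0 v0 : 'rV[R]_2)
    (t0 t : R) : 'rV[R]_2 :=
  let Pi1 := orth_proj (@line1 R) in
  let Pi2 := orth_proj (line2 theta) in
  if t <= t0 then u0 + t *: Pi1 v0 else (t - t0) *: Pi2 (Pi1 v0).

(* Main.v *)
Require Import Defs.
From HB Require Import structures.
From mathcomp Require Import all_boot all_order all_algebra.
From mathcomp Require Import all_classical all_reals all_analysis.
From mathcomp Require Import measurable_realfun.
From mathcomp Require Import ring lra.

Set Implicit Arguments.
Unset Strict Implicit.
Unset Printing Implicit Defensive.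

Import Order.TTheory GRing.Theory Num.Theory.
Import numFieldNormedType.Exports.

Local Open Scope classical_set_scope.
Local Open Scope ring_scope.

(** The angle between the two outward normals of the cone is less than a right
    angle, and therefore the penalized trajectory never comes back inside the
    cone: it leaves through the face [x_1 = 0], crosses the normal cone of the
    vertex once, and then stays for ever outside the second face.  Off the cone
    the force is continuous, so that a Lipschitz velocity that satisfies the
    equation almost everywhere is in fact differentiable and satisfies it
    everywhere ([ae_derive], [motion_acceleration]); from then on the argument
    is classical calculus, and it applies to any solution, so no uniqueness
    result is involved.

    Outside a face with unit outward normal [nu], and as long as the nearest
    point is on that face, the normal coordinate [z] solves
    [z'' + 2 alpha sqrt k z' + k z = 0] and the tangential one is affine
    ([face_phase]).  Since [alpha > 1] the characteristic roots are real and
    negative, so that [z] stays positive once it starts with a positive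
    velocity: the regime persists until the tangential coordinate reaches the
    vertex.  Moreover [z = O(1 / sqrt k)] ([face_penetration]), and a
    trajectory that starts on the face has, a fixed time later, both
    [sqrt k z] and [z'] of size [O(1 / sqrt k)] ([face_relaxation]): the normal
    velocity has been dissipated, which is where [Pi_1] comes from.

    The particle thus leaves the first regime at the time [t0], at a point
    [(eps, 0)] with [sqrt k eps = O(1 / sqrt k)], and with a velocity close to
    [(0, D)], where [D] is the initial speed along the face.  In the normal
    cone of the vertex the projection is [0] and no component of the velocity
    is exempt from a force of size [O(sqrt k)], but at that speed the region is
    crossed within a time [O(eps)]: the impulse received is [O(sqrt k eps)],
    which tends to zero ([corner_phase]).  The particle therefore enters the
    region of the second face with velocity close to [(0, D)], from the vertex
    and with positive normal and tangential components; the same face analysis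
    applies ([slide_phase]), the tangential velocity being close to
    [D cos theta], which is [Pi_2 Pi_1].  Adding up the three regimes gives an
    error [O(1 / sqrt k)] on each bounded time interval ([tracking_error],
    [convergence_rate]). *)

(** * Lipschitz functions with an almost everywhere known derivative *)

Lemma interval_induction (R : realType) (P : R -> Prop) (a b : R) :
  a <= b -> P a ->
  (forall x, a <= x -> x < b -> P x ->
     exists2 d, 0 < d & forall y, x < y -> y < x + d -> y <= b -> P y) ->
  (forall x, a < x -> x <= b -> (forall y, a <= y -> y < x -> P y) -> P x) ->
  forall x, a <= x -> x <= b -> P x.
Proof.
move=> ab Pa Pr Pl.
pose S : set R := [set x | a <= x <= b /\ forall y, a <= y -> y <= x -> P y].
have Sa : S a.
  split; first by rewrite lexx.
  by move=> y ay ya; rewrite (_ : y = a)//; apply/eqP; rewrite eq_le ay ya.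
have hS : has_sup S.
  by split; [exists a|exists b => x [/andP[]]].
set s := sup S.
have as_ : a <= s by apply: (ub_le_sup _ Sa); exact: hS.2.
have sb : s <= b by apply: ge_sup => [|x [/andP[]]]//; exists a.
have below y : a <= y -> y < s -> P y.
  move=> ay ys; have [z [_ Sz] yz] := sup_gt (ex_intro _ _ Sa) ys.
  by apply: Sz => //; exact: ltW.
have Ps : P s.
  move: as_; rewrite le_eqVlt => /predU1P[<-//|as_].
  exact: Pl.
have Ss y : a <= y -> y <= s -> P y.
  by move=> ay; rewrite le_eqVlt => /predU1P[->//|]; exact: below.
move=> x ax xb; have [xs|sx] := leP x s; first exact: Ss.
have [d d0 Pd] := Pr s as_ (lt_le_trans sx xb) Ps.
pose z := Num.min x (s + d / 2).
have sz : s < z by rewrite lt_min sx ltrDl divr_gt0.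
suff : S z.
  by move=> /(ub_le_sup hS.2); rewrite -/s leNgt sz.
split.
  by rewrite (le_trans as_ (ltW sz)) /z ge_min xb.
move=> y ay yz; have [ys|sy] := leP y s; first exact: Ss.
move: yz; rewrite le_min => /andP[yx yd].
apply: Pd => //; last exact: le_trans yx xb.
by rewrite (le_lt_trans yd)// ltrD2l; lra.
Qed.

(** The form of differentiability that is convenient for the estimates below,
    in which the increment is never divided. *)
Lemma is_deriveP_eps (R : realType) (V : normedModType R) (f : R -> V)
    (x : R) (l : V) :
  is_derive x 1 f l <->
  forall e, 0 < e -> exists2 d, 0 < d &
    forall y, `|y - x| < d -> `|f y - f x - (y - x) *: l| <= e * `|y - x|.
Proof.
split=> [[df <-] e e0|H].
  have /cvgrPdist_le /(_ e e0) [d /= d0 Hd] := df.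
  exists d => // y yd; have [->|yx] := eqVneq y x.
    by rewrite !subrr scale0r subr0 !normr0 mulr0.
  have := Hd (y - x); rewrite /ball_/= sub0r normrN => /(_ yd).
  rewrite subr_eq0 => /(_ yx).
  rewrite scaler1 subrK => Hle.
  have y0 : y - x != 0 by rewrite subr_eq0.
  rewrite -ler_pdivrMr ?normr_gt0// mulrC -normfV -normrZ scalerBr scalerA.
  by rewrite mulVf// scale1r distrC.
have cvl : h^-1 *: (f (h *: (1:R) + x) - f x) @[h --> 0^'] --> l.
  apply/cvgrPdist_le => e e0.
  have [d d0 Hd] := H e e0.
  exists d => //= h; rewrite /ball_/= sub0r normrN => hd h0.
  have := Hd (h + x); rewrite addrK scaler1 => /(_ hd) Hle.
  rewrite -ler_pdivrMr ?normr_gt0// mulrC -normfV -normrZ scalerBr scalerA in Hle.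
  by move: Hle; rewrite mulVf// scale1r distrC.
split; first by apply/cvg_ex; exists l.
exact: cvg_lim.
Qed.

Section growth.
Context (R : realType).
Let mu : {measure set (measurableTypeR R) -> \bar R} := @lebesgue_measure R.

Lemma negligible_open_cover (E : set R) (eta : R) :
  mu.-negligible E -> 0 < eta ->
  exists U : set R, [/\ open U, E `<=` U & (mu U < eta%:E)%E].
Proof.
move=> [A [mA A0 EA]] eta0.
have A0' : (mu A < +oo)%E by rewrite A0 ltry.
have [U [oU AU muU]] := lebesgue_regularity_outer mA A0' eta0.
exists U; split => //; first exact: subset_trans AU.
have mU : measurable (U : set (measurableTypeR R)) by exact: open_measurable.
rewrite (_ : U = A `|` (U `\` A)); last by rewrite setDUK.
rewrite measureU//; [by rewrite [X in (X + _)%E](_ : _ = 0%E) ?add0e|exact: measurableD|].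
by rewrite setDIK.
Qed.

Variable V : normedModType R.

(** Let [U] be an open set of small measure that contains the exceptional
    times, and [phi x] the measure of [U `&` [a, x]].  Outside [U] the
    derivative controls the growth of [g]; inside [U] the Lipschitz constant
    does, and there [phi] grows at unit speed.  Hence [M * phi] compensates for
    the exceptional times, at a total cost [M * phi b] which is arbitrarily
    small. *)
Lemma lipschitz_growth (g : R -> V) (a b M e : R) :
  a <= b -> 0 <= M -> 0 <= e ->
  (forall x y, a <= x -> x <= y -> y <= b -> `|g y - g x| <= M * (y - x)) ->
  (\forall t \ae mu, a < t < b -> derivable g t 1 /\ `|'D_1 g t| <= e) ->
  `|g b - g a| <= e * (b - a).
Proof.
move=> ab M0 e0 lipg [N [mN N0 sN]].
(* The left end point is added to the exceptional set: nothing is known about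
   the derivative there. *)
have negE : mu.-negligible (N `|` [set a]).
  apply: negligibleU; first by exists N; split.
  exists [set a]; split => //.
  exact: lebesgue_measure_set1.
suff key eta : 0 < eta -> `|g b - g a| <= (e + eta) * (b - a) + M * eta.
  apply/ler_addgt0Pr => z z0.
  pose eta := z / (b - a + M + 1).
  have D0 : 0 < b - a + M + 1 by lra.
  have eta0 : 0 < eta by rewrite divr_gt0.
  apply: le_trans (key _ eta0) _.
  have -> : z = eta * (b - a + M + 1) by rewrite /eta divfK// gt_eqF.
  nra.
move=> eta0.
have [U [oU NU muU]] := negligible_open_cover negE eta0.
have mU : measurable (U : set (measurableTypeR R)) by exact: open_measurable.
pose I x : set (measurableTypeR R) := U `&` `[a, x].
have mI x : measurable (I x) by apply: measurableI.
have fI x : mu (I x) \is a fin_num.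
  rewrite ge0_fin_numE//; apply: le_lt_trans (lt_trans muU (ltry _)).
  by apply: le_measure; rewrite ?inE//; apply: subIsetl.
pose phi x := fine (mu (I x)).
have phi0 x : 0 <= phi x by exact: fine_ge0.
have phie x : phi x <= eta.
  rewrite -lee_fin /phi fineK//; apply: le_trans (ltW muU).
  by apply: le_measure; rewrite ?inE//; apply: subIsetl.
have phile x y : x <= y -> phi x <= phi y.
  move=> xy; apply: fine_le => //.
  apply: le_measure; rewrite ?inE//; apply: setIS => z /=.
  by rewrite !in_itv/= => /andP[-> /le_trans]; exact.
have phiD x y : a <= x -> x <= y -> (forall z, x < z -> z <= y -> U z) ->
    phi y = phi x + (y - x).
  move=> ax xy xyU.
  have Exy : I y = I x `|` `]x, y].
    apply/seteqP; split => z /=; rewrite /I /= !in_itv/=.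
      move=> [Uz /andP[az zy]]; have [zx|xz] := leP z x; first by left; rewrite az.
      by right.
    move=> [[Uz /andP[-> zx]]|/andP[xz zy]]; first by split => //=; exact: le_trans xy.
    by split; [exact: xyU|rewrite zy andbT (le_trans ax (ltW xz))].
  have muxy : @lebesgue_measure R [set` `]x, y]] = (y - x)%:E.
    rewrite lebesgue_measure_itv/= lte_fin.
    move: xy; rewrite le_eqVlt => /predU1P[->|->//].
    by rewrite ltxx subrr.
  apply: EFin_inj; rewrite EFinD /phi !fineK// Exy measureU//.
    by congr (_ + _)%E; exact: muxy.
  rewrite -subset0 => z [/= [_]]; rewrite !in_itv/= => /andP[_ zx] /andP[xz _].
  by move: (lt_le_trans xz zx); rewrite ltxx.
have [] := lexx b; have [] := ab.
pose P x := `|g x - g a| <= (e + eta) * (x - a) + M * phi x.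
suff : P b.
  move=> Pb _ _; apply: le_trans Pb _; rewrite lerD2l ler_wpM2l//.
apply: (@interval_induction _ P a b ab) => //.
- by rewrite /P !subrr normr0 mulr0 add0r mulr_ge0.
- move=> x ax xb Px.
  have step y : x <= y -> `|g y - g x| <= (e + eta) * (y - x) + M * (phi y - phi x) -> P y.
    rewrite /P => xy Hy; rewrite -(subrKA (g x)) (le_trans (ler_normD _ _))//.
    by move: Px Hy; rewrite /P; nra.
  have [Ux|nUx] := pselect (U x).
    have /nbhs_ballP [d /= d0 Hd] := open_nbhs_nbhs (conj oU Ux).
    exists d => // y xy yd yb; apply: step; first exact: ltW.
    rewrite (phiD x y) ?(ltW xy)//; last first.
      move=> z xz zy; apply: Hd; rewrite /ball/= distrC ger0_norm ?subr_ge0 ?ltW//.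
      by rewrite ltrBlDl (le_lt_trans zy).
    apply: le_trans (lipg _ _ ax (ltW xy) yb) _.
    by rewrite (addrC (phi x)) addrK lerDr mulr_ge0 ?subr_ge0 ?addr_ge0//; exact: ltW.
  have xa : a < x.
    rewrite lt_neqAle ax andbT; apply/eqP => ax'; apply: nUx; apply: NU.
    by right; rewrite /= ax'.
  have [dg De] : derivable g x 1 /\ `|'D_1 g x| <= e.
    apply: contrapT => H; apply: nUx; apply: NU; left; apply: sN => /= H'.
    by apply: H; apply: H'; rewrite xa.
  have /is_deriveP_eps /(_ eta eta0) [d d0 Hd] : is_derive x 1 g ('D_1 g x) by split.
  exists d => // y xy yd yb; apply: step; first exact: ltW.
  have yx0 : 0 < y - x by rewrite subr_gt0.
  have := Hd y; rewrite gtr0_norm// ltrBlDl => /(_ yd) Hy.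
  have := ler_normD (g y - g x - (y - x) *: 'D_1 g x) ((y - x) *: 'D_1 g x).
  rewrite subrK normrZ gtr0_norm// => Hn; apply: le_trans Hn _.
  have := phile x y (ltW xy); nra.
- move=> x ax xb H; rewrite /P.
  apply/ler_addgt0Pr => z z0.
  pose y := Num.max a (x - z / (M + 1)).
  have M1 : 0 < M + 1 by lra.
  have yx : y < x by rewrite gt_max ax/= ltrBlDr ltrDl divr_gt0.
  have ay : a <= y by rewrite le_max lexx.
  have := H y ay yx; rewrite /P => Hy.
  have := lipg _ _ ay (ltW yx) xb => Hxy.
  rewrite -(subrKA (g y)) (le_trans (ler_normD _ _))//.
  have yz : x - y <= z / (M + 1) by rewrite lerBlDl -lerBlDr le_max lexx orbT.
  have zM : z = (z / (M + 1)) * (M + 1) by rewrite divfK// gt_eqF.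
  have := phile y x (ltW yx) => Hp.
  have : M * (x - y) <= M * (z / (M + 1)) by rewrite ler_wpM2l.
  have : 0 <= z / (M + 1) by rewrite divr_ge0 ?ltW.
  have : M * phi y <= M * phi x by rewrite ler_wpM2l.
  have : (e + eta) * (y - a) <= (e + eta) * (x - a).
    by rewrite ler_wpM2l// ?addr_ge0 ?lerB// ltW.
  move: yz zM; move: (z / (M + 1)) => w ? ?; nra.
Qed.

(** Near [t] the function [g s - s *: f t] is Lipschitz and has almost
    everywhere a derivative [f s - f t], which is small by continuity of [f]. *)
Lemma ae_derive (g f : R -> V) (t M d : R) : 0 < d -> 0 <= M ->
  (forall x y, t - d <= x -> x <= y -> y <= t + d -> `|g y - g x| <= M * (y - x)) ->
  {for t, continuous f} ->
  (\forall s \ae mu, t - d < s < t + d -> is_derive s 1 g (f s)) ->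
  is_derive t 1 g (f t).
Proof.
move=> d0 M0 lipg cf aeg; apply/is_deriveP_eps => e e0.
have /cvgrPdist_le /(_ e e0) /nbhs_ballP [r /= r0 Hr] := cf.
pose rd := Num.min r d.
have rd0 : 0 < rd by rewrite lt_min r0 d0.
exists rd => // y.
rewrite lt_min => /andP[yr yd].
pose h s := g s - s *: f t.
have -> : g y - g t - (y - t) *: f t = h y - h t.
  by rewrite /h scalerBl !opprD !opprK addrACA.
have dlin s : is_derive s (1:R) (fun s : R => s *: f t) (f t).
  apply/is_deriveP_eps => e' e'0; exists 1 => // z _.
  by rewrite -scalerBl subrr normr0 mulr_ge0// ltW.
have main x z : `|x - t| < rd -> `|z - t| < rd -> x <= z -> `|h z - h x| <= e * (z - x).
  move=> xt zt xz; apply: (@lipschitz_growth h x z (M + `|f t|)) => //.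
  - by rewrite addr_ge0.
  - exact: ltW.
  - move=> p q xp pq qz.
    have -> : h q - h p = (g q - g p) - (q - p) *: f t.
      by rewrite /h scalerBl !opprD !opprK addrACA.
    rewrite (le_trans (ler_normB _ _))// mulrDl lerD//.
      have rdd : rd <= d by rewrite ge_min lexx orbT.
      move: xt zt; rewrite !ltr_norml => /andP[xt1 xt2] /andP[zt1 zt2].
      by apply: lipg => //; lra.
    by rewrite normrZ mulrC ger0_norm// subr_ge0.
  - move: aeg; apply: negligibleS => s /= ns Hs; apply: ns => /andP[xs sz].
    move: xt zt; rewrite !ltr_norml => /andP[xt1 xt2] /andP[zt1 zt2].
    have rdr : rd <= r by rewrite ge_min lexx.
    have rdd : rd <= d by rewrite ge_min lexx orbT.
    have dg : is_derive s 1 g (f s) by apply: Hs; apply/andP; split; lra.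
    have dh : is_derive s 1 h (f s - f t) by apply: is_deriveB.
    split; first exact: ex_derive.
    rewrite (@derive_val _ _ _ _ _ _ _ dh) distrC; apply: Hr.
    by rewrite /ball/= ltr_norml; apply/andP; split; lra.
have yrd : `|y - t| < rd by rewrite lt_min yr.
have trd : `|t - t| < rd by rewrite subrr normr0.
have [ty|yt] := leP t y.
  by rewrite [`|y - t|]ger0_norm ?subr_ge0//; exact: main.
rewrite distrC [`|y - t|]distrC [`|t - y|]gtr0_norm ?subr_gt0//.
exact: (main _ _ yrd trd (ltW yt)).
Qed.

End growth.

(** * Euclidean geometry of the plane and of the cone *)

Section plane.
Variable R : realType.
Implicit Types (u v w p q : 'rV[R]_2) (a b : R).

Lemma dotE u v : dot u v = u 0 0 * v 0 0 + u 0 1 * v 0 1.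
Proof. by rewrite /dot big_ord_recl big_ord1; congr (_ + u 0 _ * v 0 _); apply: val_inj. Qed.

Lemma vec2_0 a b : (vec2 a b) 0 0 = a. Proof. by rewrite mxE. Qed.
Lemma vec2_1 a b : (vec2 a b) 0 1 = b. Proof. by rewrite mxE. Qed.

Lemma dot_vec2 u a b : dot u (vec2 a b) = u 0 0 * a + u 0 1 * b.
Proof. by rewrite dotE vec2_0 vec2_1. Qed.

Lemma vec2_eta u : u = vec2 (u 0 0) (u 0 1).
Proof.
apply/rowP => i; rewrite mxE; case: i => -[|[|//]] i /=.
  by congr (u 0 _); apply: val_inj.
by congr (u 0 _); apply: val_inj.
Qed.

Lemma dotC u v : dot u v = dot v u.
Proof. by rewrite !dotE; ring. Qed.
Lemma dotBl u v w : dot (u - v) w = dot u w - dot v w.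
Proof. by rewrite !dotE !mxE; ring. Qed.
Lemma dotZl a u v : dot (a *: u) v = a * dot u v.
Proof. by rewrite !dotE !mxE; ring. Qed.
Lemma dotBr u v w : dot w (u - v) = dot w u - dot w v.
Proof. by rewrite !dotE !mxE; ring. Qed.
Lemma dotZr a u v : dot v (a *: u) = a * dot v u.
Proof. by rewrite !dotE !mxE; ring. Qed.

Lemma dotxx_ge0 u : 0 <= dot u u.
Proof. by rewrite dotE; nra. Qed.

Lemma dotxx_eq0 u : dot u u = 0 -> u = 0.
Proof.
rewrite dotE => H; rewrite (vec2_eta u).
have -> : u 0 0 = 0 by nra.
have -> : u 0 1 = 0 by nra.
by apply/rowP => i; rewrite !mxE if_same.
Qed.

Lemma enorm_sqr u : enorm u ^+ 2 = dot u u.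
Proof. by rewrite sqr_sqrtr// dotxx_ge0. Qed.

(** The variational inequality characterizes the nearest point, as
    [|u - q|^2 = |u - p|^2 + |q - p|^2 - 2 (u - p) . (q - p)]. *)
Lemma nearest_pointE (A : set 'rV[R]_2) u p :
  A p -> (forall q, A q -> dot (u - p) (q - p) <= 0) -> nearest_point A u = p.
Proof.
move=> Ap Hp.
have pyth q : dot (u - q) (u - q) =
    dot (u - p) (u - p) + dot (q - p) (q - p) - 2 * dot (u - p) (q - p).
  by rewrite !dotE !mxE; ring.
rewrite /nearest_point; case: xgetP => [y _ [Ay Hy]|/(_ p)[]].
  have := Hy p Ap; rewrite /enorm ler_sqrt ?dotxx_ge0//.
  rewrite (pyth y); have := Hp y Ay; have := dotxx_ge0 (y - p) => H1 H2 H3.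
  by apply/eqP; rewrite -subr_eq0; apply/eqP/dotxx_eq0; lra.
split=> // q Aq; rewrite /enorm ler_sqrt ?dotxx_ge0// (pyth q).
have := Hp q Aq; have := dotxx_ge0 (q - p); lra.
Qed.

Lemma orth_projE (L : set 'rV[R]_2) u p :
  L p -> (forall q, L q -> dot (u - p) q = 0) -> orth_proj L u = p.
Proof.
move=> Lp Hp; rewrite /orth_proj; case: xgetP => [y _ [Ly Hy]|/(_ p)[]//].
apply/eqP; rewrite -subr_eq0; apply/eqP/dotxx_eq0.
have -> : dot (y - p) (y - p) =
   dot (u - p) y - dot (u - p) p - (dot (u - y) y - dot (u - y) p).
  by rewrite !dotE !mxE; ring.
by rewrite !Hp ?Hy// !subr0.
Qed.

End plane.

Section acceleration.
Variables (R : realType) (theta alpha k : R).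
Implicit Types (u v q nu sigma : 'rV[R]_2).

Definition acceleration u v : 'rV[R]_2 :=
  - ((2 * alpha * Num.sqrt k) *: damping theta u v) - k *: (u - Defs.projK theta u).

(** The vector [nu] is the outward normal of a face of the cone and [sigma]
    spans that face, oriented away from the vertex. *)
Definition face nu sigma :=
  [/\ dot nu nu = 1,
      forall u, u = dot u nu *: nu + dot u sigma *: sigma,
      dot sigma nu = 0,
      forall q, coneK theta q -> dot q nu <= 0 &
      forall a, 0 <= a -> coneK theta (a *: sigma)].

Lemma acceleration_off_cone u v p :
  coneK theta p -> (forall q, coneK theta q -> dot (u - p) (q - p) <= 0) ->
  u != p ->
  acceleration u v = - (2 * alpha * Num.sqrt k * (dot v (u - p) / dot (u - p) (u - p)) + k)
     *: (u - p).
Proof.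
move=> Kp Hp up; have Ep : Defs.projK theta u = p by exact: nearest_pointE.
rewrite /acceleration /damping Ep; case: ifPn => [/set_mem Ku|_].
  have := Hp u Ku; have := dotxx_ge0 (u - p) => H0 H1.
  have /dotxx_eq0/eqP : dot (u - p) (u - p) = 0 by lra.
  by rewrite subr_eq0 (negPf up).
by rewrite enorm_sqr scalerA -scaleNr -scalerBl; congr (_ *: _); ring.
Qed.

Lemma acceleration_face nu sigma u v :
  face nu sigma -> 0 < dot u nu -> 0 <= dot u sigma ->
  acceleration u v =
    - (2 * alpha * Num.sqrt k * dot v nu + k * dot u nu) *: nu.
Proof.
move=> [nn dec sn Knu Ksig] un us.
have Ew : u - dot u sigma *: sigma = dot u nu *: nu.
  by rewrite {1}(dec u) addrK.
rewrite (@acceleration_off_cone _ _ (dot u sigma *: sigma)); first last.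
- apply/eqP => H; move: Ew; rewrite -H subrr => /(congr1 (fun z => dot z nu)).
  by rewrite dotZl nn dotE !mxE !mul0r addr0 mulr1 => H'; move: un; rewrite -H' ltxx.
- move=> q Kq; rewrite Ew dotZl dotBr dotZr [dot nu q]dotC [dot nu sigma]dotC sn mulr0 subr0.
  by have := Knu q Kq; nra.
- exact: Ksig.
rewrite Ew !(dotZl, dotZr) nn scalerA; congr (_ *: _).
by field; lra.
Qed.

(** Here [u] is a nonnegative combination of the two outward normals, that
    is, it belongs to the normal cone of the vertex: the nearest point is [0]. *)
Lemma acceleration_corner u v :
  0 < sin theta -> 0 < u 0 0 -> 0 <= u 0 1 ->
  u 0 1 * cos theta <= u 0 0 * sin theta ->
  acceleration u v =
    - (2 * alpha * Num.sqrt k * (dot v u / dot u u) + k) *: u.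
Proof.
move=> s0 x0 y0 xy.
rewrite (@acceleration_off_cone _ _ 0) ?subr0//.
- by split; rewrite !mxE ?mul0r ?addr0.
- move=> q [q0 q1]; rewrite subr0 dotE -(pmulr_rle0 _ s0).
  have -> : sin theta * (u 0 0 * q 0 0 + u 0 1 * q 0 1) =
    (u 0 0 * sin theta - u 0 1 * cos theta) * q 0 0 +
    u 0 1 * (q 0 0 * cos theta + q 0 1 * sin theta) by ring.
  nra.
- by apply/eqP => H; move: x0; rewrite H mxE ltxx.
Qed.

Lemma face_line1 : 0 < theta -> theta < pi / 2 -> face (vec2 1 0) (vec2 0 (-1)).
Proof.
move=> t0 t1.
have s0 : 0 < sin theta by apply: sin_gt0_pi; have := pi_gt0 R; lra.
split=> [|u|||].
- by rewrite dot_vec2 !mxE/=; ring.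
- rewrite !dot_vec2 [LHS]vec2_eta; apply/rowP => i; rewrite !mxE.
  by case: (i == 0); ring.
- by rewrite dot_vec2 !mxE/=; ring.
- by move=> q [q0 _]; rewrite dot_vec2; lra.
- by move=> a a0; rewrite /coneK/= !mxE/=; split; nra.
Qed.

Lemma face_line2 : 0 < theta -> theta < pi / 2 ->
  face (vec2 (cos theta) (sin theta)) (vec2 (- sin theta) (cos theta)).
Proof.
move=> t0 t1.
have s0 : 0 < sin theta by apply: sin_gt0_pi; have := pi_gt0 R; lra.
have cs := cos2Dsin2 theta.
split=> [|u|||].
- by rewrite dot_vec2 !mxE/= -cs; ring.
- rewrite !dot_vec2 [LHS]vec2_eta; apply/rowP => i; rewrite !mxE.
  case: (i == 0); last first.
    by rewrite -[LHS]mulr1 -cs; ring.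
  by rewrite -[LHS]mulr1 -cs; ring.
- by rewrite dot_vec2 !mxE/=; ring.
- by move=> q [_ q1]; rewrite dot_vec2.
- by move=> a a0; rewrite /coneK/= !mxE/=; split; [nra|lra].
Qed.

End acceleration.

(** * Solutions as motions on the whole line *)

Section motion.
Variable R : realType.
Let mu : {measure set (measurableTypeR R) -> \bar R} := @lebesgue_measure R.

Lemma rV2_norm_le (z : 'rV[R]_2) (e : R) :
  `|z 0 0| <= e -> `|z 0 1| <= e -> `|z| <= e.
Proof.
move=> z0 z1; rewrite [leLHS]/Num.Def.normr/= mx_normrE.
apply: bigmax_le => [|[i j] _ /=]; first exact: le_trans z0.
by rewrite ord1 (vec2_eta z) mxE; case: ifP.
Qed.

Lemma rV2_norm_ge (z : 'rV[R]_2) i : `|z 0 i| <= `|z|.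
Proof.
rewrite [leRHS]/Num.Def.normr/= mx_normrE.
exact: (le_bigmax _ (fun ij => `|z ij.1 ij.2|) (0, i)).
Qed.

Lemma dot_le_norm (z w : 'rV[R]_2) :
  `|dot z w| <= (`|w 0 0| + `|w 0 1|) * `|z|.
Proof.
rewrite dotE (le_trans (ler_normD _ _))// !normrM mulrDl.
by rewrite lerD// mulrC ler_wpM2l// rV2_norm_ge.
Qed.

Lemma is_derive_dot (f : R -> 'rV[R]_2) (w l : 'rV[R]_2) (t : R) :
  is_derive t 1 f l -> is_derive t 1 (fun s => dot (f s) w) (dot l w).
Proof.
move=> /is_deriveP_eps H; apply/is_deriveP_eps => e e0.
pose C := `|w 0 0| + `|w 0 1| + 1.
have C0 : 0 < C by rewrite ltr_wpDl// addr_ge0.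
have [d d0 Hd] := H (e / C) (divr_gt0 e0 C0).
exists d => // y yd; have := Hd y yd => Hy.
rewrite -dotBl [(y - t) *: _]mulrC -[dot l w * (y - t)]mulrC -dotZl -dotBl.
apply: le_trans (dot_le_norm _ _) _.
apply: (@le_trans _ _ (C * (e / C * `|y - t|))); last first.
  by rewrite mulrA [C * _]mulrC divfK// gt_eqF.
by rewrite ler_pM// ?addr_ge0// /C lerDl.
Qed.

Lemma continuous_dot (f : R -> 'rV[R]_2) (w : 'rV[R]_2) (t : R) :
  {for t, continuous f} -> {for t, continuous (fun s => dot (f s) w)}.
Proof.
move=> cf.
have cc i : f s 0 i @[s --> t] --> f t 0 i.
  apply: (@cvg_comp _ _ _ f (fun z : 'rV[R]_2 => z 0 i) _ (nbhs (f t))) => //.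
  exact: coord_continuous.
have -> : (fun s => dot (f s) w) = (fun s => f s 0 0 * w 0 0 + f s 0 1 * w 0 1).
  by apply/funext => s; rewrite dotE.
suff : f s 0 0 * w 0 0 + f s 0 1 * w 0 1 @[s --> t] -->
  f t 0 0 * w 0 0 + f t 0 1 * w 0 1 by [].
apply: (@cvgD _ R); apply: (@cvgM R).
- exact: cc.
- exact: cvg_cst.
- exact: cc.
- exact: cvg_cst.
Qed.

Lemma is_derive_eq_pos (V : normedModType R) (f g : R -> V) (t : R) (l : V) :
  0 < t -> (forall s, 0 < s -> g s = f s) -> is_derive t 1 f l -> is_derive t 1 g l.
Proof.
move=> t0 fg /is_deriveP_eps H; apply/is_deriveP_eps => e e0.
have [d d0 Hd] := H e e0.
exists (Num.min d t); first by rewrite lt_min d0.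
move=> y; rewrite lt_min => /andP[yd]; rewrite ltr_norml => /andP[y0 _].
by rewrite !fg//; [exact: Hd|lra].
Qed.

(** The functions are meant to be a solution and its velocity, both extended to
    negative times by their values at [0], which makes continuity two-sided. *)
Record motion (theta alpha k : R) (u v : R -> 'rV[R]_2) : Prop := Motion {
  motion_cont : continuous u ;
  motion_cont_velocity : continuous v ;
  motion_derive : forall t : R, 0 < t -> is_derive t 1 u (v t) ;
  motion_lipschitz : forall T : R, exists2 M : R, 0 <= M &
    forall x y : R, x <= y -> y <= T -> `|v y - v x| <= M * (y - x) ;
  motion_ae : \forall t \ae mu,
    0 < (t : R) -> is_derive (t : R) 1 v (acceleration theta alpha k (u t) (v t)) }.

(** Undivided form of the one-sided derivative, as in [is_deriveP_eps]. *)
Lemma has_derivative_within_eps (D : set R) (f : R -> 'rV[R]_2) t l :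
  has_derivative_within D f t l -> forall e, 0 < e ->
  exists2 d, 0 < d & forall y, D y -> `|y - t| < d ->
     `|f y - f t - (y - t) *: l| <= e * `|y - t|.
Proof.
move=> /cvgrPdist_le H e e0; have [d /= d0 Hd] := H e e0.
exists d => // y Dy yd; have [->|yt] := eqVneq y t.
  by rewrite !subrr scale0r subr0 !normr0 mulr0.
have := Hd y; rewrite /ball_/= distrC => /(_ yd yt Dy) Hle.
have y0 : y - t != 0 by rewrite subr_eq0.
rewrite -ler_pdivrMr ?normr_gt0// mulrC -normfV -normrZ scalerBr scalerA.
by rewrite mulVf// scale1r distrC.
Qed.

Lemma maxr0_dist (x y : R) : `|Num.max x 0 - Num.max y 0| <= `|x - y|.
Proof.
by case: (leP x 0) => ?; case: (leP y 0) => ?; rewrite ?subrr ?normr0//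
  ?sub0r ?subr0 ?normrN ler_norml; have := ler_norm (x - y);
  have := ler_norm (y - x); rewrite (distrC y x) => ? ?; apply/andP; split; lra.
Qed.

Lemma lipschitz_at_continuous (V : normedModType R) (f : R -> V) (t M d : R) :
  0 < d -> 0 <= M -> (forall y, `|y - t| < d -> `|f y - f t| <= M * `|y - t|) ->
  {for t, continuous f}.
Proof.
move=> d0 M0 Hf; apply/cvgrPdist_le => e e0.
have M1 : 0 < M + 1 by lra.
apply/nbhs_ballP; exists (Num.min d (e / (M + 1))) => /=.
  by rewrite lt_min d0 divr_gt0.
move=> y; rewrite /ball/= distrC lt_min => /andP[yd ye].
rewrite distrC (le_trans (Hf y yd))//.
apply: (@le_trans _ _ ((M + 1) * (e / (M + 1)))); last by rewrite mulrC divfK// gt_eqF.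
by rewrite ler_pM// ?ltW//; lra.
Qed.

Lemma penalized_motion (theta alpha k : R) u0 v0 (u : R -> 'rV[R]_2) :
  penalized_solution theta alpha k u0 v0 u ->
  exists U V, [/\ motion theta alpha k U V, forall t, 0 <= t -> U t = u t,
    U 0 = u0 & V 0 = v0].
Proof.
move=> [v [[du _] lipv aev u00 v00]].
pose U t := u (Num.max t 0); pose V t := v (Num.max t 0).
have UE t : 0 <= t -> U t = u t by move=> t0; rewrite /U max_l.
have VE t : 0 <= t -> V t = v t by move=> t0; rewrite /V max_l.
have lipV T : exists2 M : R, 0 <= M &
    forall x y, x <= y -> y <= T -> `|V y - V x| <= M * (y - x).
  pose T' := Num.max T 1.
  have T'0 : 0 < T' by rewrite lt_max ltr01 orbT.
  have [M0 [_ HM]] := lipv T' T'0.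
  pose M := Num.max M0 0 + 1.
  have M0M : M0 < M by rewrite /M ltr_pwDr// le_max lexx.
  have M_ge0 : 0 <= M by rewrite addr_ge0// le_max lexx orbT.
  exists M => // x y xy yT.
  have in0T z : z <= T -> 0 <= Num.max z 0 <= T'.
    move=> zT; rewrite le_max lexx orbT/= ge_max le_max zT/=.
    by rewrite ltW.
  have := HM M M0M (Num.max y 0, Num.max x 0); rewrite /= !in_itv/=.
  rewrite !in0T//; last exact: le_trans yT.
  move=> /(_ (conj isT isT)) H; rewrite (le_trans H)//.
  by rewrite ler_wpM2l// (le_trans (maxr0_dist _ _))// ger0_norm// subr_ge0.
exists U, V; split => //; last 2 first.
- by rewrite UE.
- by rewrite VE.
split.
- move=> t; pose tau := Num.max t 0.
  have tau0 : 0 <= tau by rewrite le_max lexx orbT.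
  have [d d0 Hd] := has_derivative_within_eps (du tau tau0) ltr01.
  apply: (@lipschitz_at_continuous _ _ t (1 + `|v tau|) d) => // y yd.
  have := maxr0_dist y t => yt.
  have := Hd (Num.max y 0); rewrite /= in_itv/= andbT le_max lexx orbT.
  move=> /(_ isT (le_lt_trans yt yd)); rewrite -/(U y) -/(U t) mul1r => H.
  apply: (@le_trans _ _ ((1 + `|v tau|) * `|Num.max y 0 - tau|)); last first.
    by rewrite ler_wpM2l// addr_ge0.
  rewrite -[U y - U t](subrK ((Num.max y 0 - tau) *: v tau)).
  rewrite (le_trans (ler_normD _ _))// mulrDl mul1r lerD//.
  by rewrite normrZ mulrC.
- move=> t; have [M M0 HM] := lipV (t + 1).
  apply: (@lipschitz_at_continuous _ _ t M 1) => // y; rewrite ltr_norml => /andP[y1 y2].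
  have [ty|yt] := leP t y.
    by rewrite [`|y - t|]ger0_norm ?subr_ge0//; apply: HM => //; lra.
  rewrite distrC [`|y - t|]ltr0_norm ?subr_lt0// opprB.
  by apply: HM; lra.
- move=> t t0; apply/is_deriveP_eps => e e0.
  have [d d0 Hd] := has_derivative_within_eps (du t (ltW t0)) e0.
  exists (Num.min d t); first by rewrite lt_min d0.
  move=> y; rewrite lt_min => /andP[yd]; rewrite ltr_norml => /andP[y0 _].
  have y0' : 0 <= y by lra.
  rewrite (VE _ (ltW t0)) (UE _ (ltW t0)) (UE _ y0').
  by apply: Hd => //=; rewrite in_itv/= andbT; lra.
- exact: lipV.
- move: aev; apply: negligibleS => t /= nt Ht; apply: nt => t0.
  have [dv eqv] := Ht t0.
  apply: (@is_derive_eq_pos _ v) => // [s s0|]; first by rewrite VE ?ltW.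
  rewrite UE ?ltW// VE ?ltW//.
  suff -> : acceleration theta alpha k (u t) (v t) = 'D_1 v t by split.
  apply/eqP; rewrite eq_sym -subr_eq0 -eqv /acceleration opprB opprK.
  by rewrite addrA addrAC.
Qed.

(** As soon as the acceleration coincides near [t] with a continuous function of
    time, the equation holds at [t] and not only almost everywhere. *)
Lemma motion_acceleration theta alpha k u v (f : R -> 'rV[R]_2) (t : R) :
  motion theta alpha k u v -> 0 < t ->
  {for t, continuous f} ->
  (\forall s \near t, acceleration theta alpha k (u s) (v s) = f s) ->
  is_derive t 1 v (f t).
Proof.
move=> [_ _ _ lipv aev] t0 cf /nbhs_ballP [r /= r0 Hr].
pose d := Num.min r t.
have d0 : 0 < d by rewrite lt_min r0.
have dr : d <= r by rewrite ge_min lexx.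
have dt : d <= t by rewrite ge_min lexx orbT.
have [M M0 HM] := lipv (t + d).
apply: (@ae_derive _ _ v f t M d) => //.
  by move=> x y _ xy yt; exact: HM.
move: aev; apply: negligibleS => s /= ns Hs; apply: ns => /andP[s1 s2].
rewrite -Hr; first by apply: Hs; lra.
by rewrite /ball/= ltr_norml; apply/andP; split; lra.
Qed.

End motion.

(** * One-variable calculus *)

Section scalar.
Variable R : realType.
Implicit Types (g h x p : R -> R) (a b t : R).

Lemma cont_cst (c : R) : continuous (fun _ : R => c).
Proof. by move=> t; exact: cvg_cst. Qed.
Lemma cont_id : continuous (fun t : R => t).
Proof. by move=> t; exact: cvg_id. Qed.
Lemma cont_mul g h : continuous g -> continuous h -> continuous (fun t => g t * h t).
Proof. by move=> cg ch t; exact: (cvgM (cg t) (ch t)). Qed.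
Lemma cont_add g h : continuous g -> continuous h -> continuous (fun t => g t + h t).
Proof. by move=> cg ch t; exact: (cvgD (cg t) (ch t)). Qed.
Lemma cont_opp g : continuous g -> continuous (fun t => - g t).
Proof. by move=> cg t; exact: (cvgN (cg t)). Qed.
Lemma cont_sub g h : continuous g -> continuous h -> continuous (fun t => g t - h t).
Proof. by move=> cg ch t; exact: (cvgB (cg t) (ch t)). Qed.
Lemma cont_min g h : continuous g -> continuous h ->
  continuous (fun t => Num.min (g t) (h t)).
Proof. by move=> cg ch t; apply: continuous_min; [exact: cg|exact: ch]. Qed.
Lemma cont_norm g : continuous g -> continuous (fun t => `|g t|).
Proof. by move=> cg t; exact: (cvg_norm (cg t)). Qed.

Lemma MVT_le g h a b : a <= b -> continuous g ->
  (forall t, a < t -> t < b -> is_derive t 1 g (h t)) ->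
  exists c, [/\ a <= c, c <= b & g b - g a = h c * (b - a)].
Proof.
move=> ab cg dg.
have [t||c] := @MVT_segment R g h a b ab.
- by rewrite in_itv/= => /andP[? ?]; exact: dg.
- exact: continuous_subspaceT.
by rewrite in_itv/= => /andP[? ?] ?; exists c.
Qed.

Lemma MVT_lt g h a b : a < b -> continuous g ->
  (forall t, a < t -> t < b -> is_derive t 1 g (h t)) ->
  exists c, [/\ a < c, c < b & g b - g a = h c * (b - a)].
Proof.
move=> ab cg dg.
have [t||c] := @MVT R g h a b ab.
- by rewrite in_itv/= => /andP[? ?]; exact: dg.
- exact: continuous_subspaceT.
by rewrite in_itv/= => /andP[? ?] ?; exists c.
Qed.

Lemma continuous_gt0_near g t : continuous g -> 0 < g t ->
  exists2 d, 0 < d & forall s, `|s - t| < d -> 0 < g s.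
Proof.
move=> cg g0; have /cvgrPdist_lt /(_ _ g0) /nbhs_ballP [d /= d0 Hd] := cg t.
exists d => // s sd; have := Hd s; rewrite /ball/= distrC => /(_ sd).
by rewrite ltr_norml => /andP[]; lra.
Qed.

(** A continuous function that starts positive either stays positive or has a
    first zero; this turns all the a priori estimates below into proofs by
    contradiction at the first zero. *)
Lemma first_exit g a b : a <= b -> continuous g -> 0 < g a ->
  (forall t, a <= t -> t <= b -> 0 < g t) \/
  exists t1, [/\ a < t1, t1 <= b, g t1 = 0 & forall t, a <= t -> t < t1 -> 0 < g t].
Proof.
move=> ab cg ga; have [|H] := pselect (exists t1, [/\ a < t1, t1 <= b, g t1 = 0 &
  forall t, a <= t -> t < t1 -> 0 < g t]); first by right.
left; apply: (@interval_induction _ (fun t => 0 < g t)) => // [t at_ tb gt|t at_ tb gt].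
  have [d d0 Hd] := continuous_gt0_near cg gt.
  exists d => // y ty yd _; apply: Hd; rewrite gtr0_norm ?subr_gt0//; lra.
rewrite ltNge; apply/negP; rewrite le_eqVlt => /predU1P[gt0|gt0].
  by apply: H; exists t.
have [||d d0 Hd] := @continuous_gt0_near (fun s => - g s) t.
- by move=> s; apply: continuousN; exact: cg.
- by rewrite oppr_gt0.
pose y := Num.max a (t - d / 2).
have yt : y < t by rewrite gt_max at_; lra.
have ya : a <= y by rewrite le_max lexx.
have yd : t - d / 2 <= y by rewrite le_max lexx orbT.
have := gt y ya yt; have := Hd y; rewrite ltr0_norm ?subr_lt0// => Hy gy.
suff : 0 < - g y by lra.
by apply: Hy; lra.
Qed.

Lemma positive_right g h a : continuous g -> continuous h ->
  (forall t, a < t -> is_derive t 1 g (h t)) ->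
  0 <= g a -> (g a = 0 -> 0 < h a) ->
  exists2 d, 0 < d & forall t, a < t -> t < a + d -> 0 < g t.
Proof.
move=> cg ch dg ga0 ha0.
have [ga|ga] := eqVneq (g a) 0; last first.
  have ga1 : 0 < g a by rewrite lt_neqAle eq_sym ga.
  have [d d0 Hd] := continuous_gt0_near cg ga1.
  by exists d => // t t1 t2; apply: Hd; rewrite gtr0_norm; lra.
have [d d0 Hd] := continuous_gt0_near ch (ha0 ga).
exists d => // t t1 t2.
have [s s1 _|c [c1 c2]] := @MVT_lt g h a t t1 cg; first exact: dg.
have : 0 < h c by apply: Hd; rewrite gtr0_norm; lra.
move: (h c) => m m0; rewrite ga; nra.
Qed.

Lemma derive0_const g a b : a <= b -> continuous g ->
  (forall t, a < t -> t < b -> is_derive t 1 g 0) -> g b = g a.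
Proof.
move=> ab cg dg; have [c [_ _]] := @MVT_le g (fun=> 0) a b ab cg dg.
by rewrite mul0r => /eqP; rewrite subr_eq0 => /eqP.
Qed.

(** If [x'' + (r + s) x' + r s x = 0], then [x' + r x] is an eigenfunction: it
    decays at the rate [s]. *)
Lemma overdamped_mode x p (r s a b : R) : a <= b -> continuous x -> continuous p ->
  (forall t, a < t -> t < b -> is_derive t 1 x (p t)) ->
  (forall t, a < t -> t < b -> is_derive t 1 p (- ((r + s) * p t + r * s * x t))) ->
  p b + r * x b = (p a + r * x a) * expR (- s * (b - a)).
Proof.
move=> ab cx cp dx dp.
pose f t := expR (s * (t - a)) * (p t + r * x t).
have cf : continuous f.
  apply: cont_mul; last by apply: cont_add => //; apply: cont_mul => //; exact: cont_cst.
  move=> t; apply: (@continuous_comp _ _ _ (fun t => s * (t - a)) expR).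
    apply: cont_mul; first exact: cont_cst.
    by apply: cont_sub; [exact: cont_id|exact: cont_cst].
  exact: continuous_expR.
have df t : a < t -> t < b -> is_derive t 1 f 0.
  move=> at_ tb; have := dx t at_ tb; have := dp t at_ tb => dp' dx'.
  have dlin : is_derive t (1 : R) (fun t => s * (t - a)) s.
    apply/is_deriveP_eps => e e0; exists 1 => // y _.
    have -> : s * (y - a) - s * (t - a) - (y - t) *: s = 0.
      by rewrite [(y - t) *: s]mulrC; ring.
    by rewrite normr0 mulr_ge0// ltW.
  have dexp : is_derive t (1 : R) (fun t => expR (s * (t - a))) (expR (s * (t - a)) * s).
    exact: (@is_derive1_comp R expR (fun t => s * (t - a)) t _ _ _ dlin).
  have drx : is_derive t (1 : R) (fun t => r * x t) (r * p t).
    exact: (@is_deriveZ _ _ _ x r).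
  have dsum : is_derive t (1 : R) (fun t => p t + r * x t)
     (- ((r + s) * p t + r * s * x t) + r * p t).
    exact: is_deriveD.
  have [D1 D2] := is_deriveM dexp dsum.
  split; first exact: D1.
  by rewrite [LHS]D2 /GRing.scale/=; ring.
have := derive0_const ab cf df.
rewrite /f subrr mulr0 expR0 mul1r => <-.
rewrite mulrAC -expRD mulNr addrN expR0 mul1r //.
Qed.

End scalar.

Lemma MVT_bound (R : realType) (g h : R -> R) (a b m M : R) :
  a <= b -> continuous g ->
  (forall t : R, a < t -> t < b -> is_derive t 1 g (h t)) ->
  (forall t, a < t -> t < b -> `|h t - m| <= M) ->
  `|g b - g a - m * (b - a)| <= M * (b - a).
Proof.
rewrite le_eqVlt => /predU1P[->|ab] cg dg hM.
  by rewrite !subrr !mulr0 subr0 normr0.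
have [c [c1 c2 ->]] := MVT_lt ab cg dg.
rewrite -mulrBl normrM [`|b - a|]gtr0_norm ?subr_gt0//.
by rewrite ler_wpM2r ?hM// subr_ge0 ltW.
Qed.

(** * Motion outside a face *)

(** The difference of the two exponential modes stays positive because the
    slow mode has the larger amplitude. *)
Lemma mode_gap (R : realType) (V A B e1 e2 : R) :
  0 < V -> 0 <= A -> A <= B -> 0 < e2 -> e2 < e1 ->
  0 < (V + B) * e1 - (V + A) * e2.
Proof.
move=> V0 A0 AB e20 e21.
have -> : (V + B) * e1 - (V + A) * e2 = (V + A) * (e1 - e2) + (B - A) * e1 by ring.
apply: ltr_wpDr.
  by rewrite mulr_ge0 ?subr_ge0// ltW// (lt_trans e20).
by rewrite mulr_gt0 ?subr_gt0// ltr_wpDr.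
Qed.

Section face_phase.
Variables (R : realType) (theta alpha k : R) (u v : R -> 'rV[R]_2).
Hypothesis mo : motion theta alpha k u v.
Variables (nu sigma : 'rV[R]_2).
Hypothesis fc : face theta nu sigma.

Lemma cont_dot (f : R -> 'rV[R]_2) w : continuous f -> continuous (fun t => dot (f t) w).
Proof. by move=> cf t; exact: continuous_dot (cf t). Qed.

Let cu w : continuous (fun t => dot (u t) w).
Proof. by apply: cont_dot; exact: motion_cont mo. Qed.
Let cv w : continuous (fun t => dot (v t) w).
Proof. by apply: cont_dot; exact: motion_cont_velocity mo. Qed.

Lemma motion_derive_dot w (t : R) : 0 < t ->
  is_derive t 1 (fun s => dot (u s) w) (dot (v t) w).
Proof. by move=> t0; apply/is_derive_dot/(motion_derive mo). Qed.

Lemma face_acceleration (t : R) : 0 < t -> 0 < dot (u t) nu -> 0 < dot (u t) sigma ->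
  is_derive t 1 v (- (2 * alpha * Num.sqrt k * dot (v t) nu + k * dot (u t) nu) *: nu).
Proof.
move=> t0 un us.
pose f s := - (2 * alpha * Num.sqrt k * dot (v s) nu + k * dot (u s) nu) *: nu.
have cc : continuous (fun s => - (2 * alpha * Num.sqrt k * dot (v s) nu + k * dot (u s) nu)).
  by apply: cont_opp; apply: cont_add; apply: cont_mul; (exact: cont_cst || exact: cu || exact: cv).
apply: (motion_acceleration (f := f) mo t0).
  by apply: cvgZ; [exact: cc|exact: cvg_cst].
have [d1 d10 Hd1] := continuous_gt0_near (@cu nu) un.
have [d2 d20 Hd2] := continuous_gt0_near (@cu sigma) us.
apply/nbhs_ballP; exists (Num.min d1 d2) => /=; first by rewrite lt_min d10.
move=> s; rewrite /ball/= distrC lt_min => /andP[sd1 sd2].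
by apply: (acceleration_face _ _ _ fc); [exact: Hd1|exact/ltW/Hd2].
Qed.

Variables (a b r1 r2 : R).
Hypotheses (a0 : 0 <= a) (ab : a < b) (r10 : 0 < r1) (r12 : r1 < r2)
  (rD : r1 + r2 = 2 * alpha * Num.sqrt k) (rM : r1 * r2 = k).
Hypotheses (x0 : 0 <= dot (u a) nu) (v0 : 0 < dot (v a) nu).
Hypotheses (ys0 : 0 <= dot (u a) sigma)
  (ys1 : dot (u a) sigma = 0 -> 0 < dot (v a) sigma).
Hypothesis y0 : forall t, a < t -> t < b ->
  0 < dot (u a) sigma + (t - a) * dot (v a) sigma.

Let good t := 0 < dot (u t) nu /\ 0 < dot (u t) sigma.

Let formulas t :=
 [/\ dot (v t) sigma = dot (v a) sigma,
     dot (u t) sigma = dot (u a) sigma + (t - a) * dot (v a) sigma,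
     dot (v t) nu + r1 * dot (u t) nu =
       (dot (v a) nu + r1 * dot (u a) nu) * expR (- r2 * (t - a)) &
     dot (v t) nu + r2 * dot (u t) nu =
       (dot (v a) nu + r2 * dot (u a) nu) * expR (- r1 * (t - a))].

Let good_formulas c : a <= c -> (forall t, a < t -> t < c -> good t) -> formulas c.
Proof.
move=> ac gd.
have [nn _ sn _ _] := fc.
have du w (t : R) : a < t -> t < c -> is_derive t 1 (fun s => dot (u s) w) (dot (v t) w).
  by move=> at_ tc; apply: motion_derive_dot; exact: le_lt_trans at_.
have dv w (t : R) : a < t -> t < c -> is_derive t 1 (fun s => dot (v s) w)
   (- (2 * alpha * Num.sqrt k * dot (v t) nu + k * dot (u t) nu) * dot nu w).
  move=> at_ tc; have [g1 g2] := gd t at_ tc.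
  rewrite -[_ * dot nu w]dotZl; apply: is_derive_dot; apply: face_acceleration => //.
  exact: le_lt_trans at_.
have vs t : a <= t -> t <= c -> dot (v t) sigma = dot (v a) sigma.
  move=> at_ tc; apply: (derive0_const at_ (@cv sigma)) => s as_ sc.
  have := dv sigma s as_ (lt_le_trans sc tc).
  by rewrite [dot nu _]dotC sn mulr0.
split.
- exact: vs.
- have [m [m1 m2]] := MVT_le ac (@cu sigma) (du sigma).
  by rewrite (vs m)// => /eqP; rewrite subr_eq addrC mulrC => /eqP.
- apply: (overdamped_mode ac (@cu nu) (@cv nu) (du nu)).
  move=> t at_ tc; have := dv nu t at_ tc; rewrite nn mulr1 -rD.
  by rewrite -rM.
- apply: (overdamped_mode ac (@cu nu) (@cv nu) (du nu)).
  move=> t at_ tc; have := dv nu t at_ tc; rewrite nn mulr1 -rD.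
  by rewrite -rM [r2 + r1]addrC [r2 * r1]mulrC.
Qed.

Let formulas_good t : a < t -> t < b -> formulas t -> good t.
Proof.
move=> at_ tb [_ us p1 p2]; split; last by rewrite us; exact: y0.
have e12 : expR (- r2 * (t - a)) < expR (- r1 * (t - a)).
  by rewrite ltr_expR !mulNr ltrN2 ltr_pM2r ?subr_gt0.
have e2 := expR_gt0 (- r2 * (t - a)).
have : (r2 - r1) * dot (u t) nu = (dot (v a) nu + r2 * dot (u a) nu) * expR (- r1 * (t - a))
   - (dot (v a) nu + r1 * dot (u a) nu) * expR (- r2 * (t - a)).
  by rewrite -p1 -p2; ring.
move: e12 e2; move: (expR _) (expR _) => e2 e1 e12 e20 E.
rewrite -(pmulr_rgt0 _ (_ : 0 < r2 - r1)) ?subr_gt0// E.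
have : 0 <= r1 * dot (u a) nu by rewrite mulr_ge0// ltW.
have : r1 * dot (u a) nu <= r2 * dot (u a) nu by rewrite ler_wpM2r// ltW.
move=> AB A0; exact: mode_gap.
Qed.

(** The formulas hold as long as the particle stays in the open quadrant where
    the nearest point is on the face, and they show that it does not leave this
    quadrant: at a first exit time they would give positive coordinates. *)
Lemma face_phase t : a <= t -> t <= b ->
 [/\ dot (v t) sigma = dot (v a) sigma,
     dot (u t) sigma = dot (u a) sigma + (t - a) * dot (v a) sigma,
     dot (v t) nu + r1 * dot (u t) nu =
       (dot (v a) nu + r1 * dot (u a) nu) * expR (- r2 * (t - a)) &
     dot (v t) nu + r2 * dot (u t) nu =
       (dot (v a) nu + r2 * dot (u a) nu) * expR (- r1 * (t - a))].
Proof.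
move=> at_ tb; apply: good_formulas => // {at_} s as_ st.
have {st tb} {}tb : s < b by exact: lt_le_trans tb.
have du w (r : R) : a < r -> is_derive r 1 (fun r => dot (u r) w) (dot (v r) w).
  by move=> as_'; apply: motion_derive_dot; exact: le_lt_trans as_'.
have [d1 d10 Hd1] := positive_right (@cu nu) (@cv nu) (@du nu) x0 (fun=> v0).
have [d2 d20 Hd2] := positive_right (@cu sigma) (@cv sigma) (@du sigma) ys0 ys1.
have sa : 0 < s - a by rewrite subr_gt0.
pose d := Num.min (s - a) (Num.min d1 d2) / 2.
have [dd1 dd2 dds d0] : [/\ d < d1, d < d2, d < s - a & 0 < d].
  have m0 : 0 < Num.min (s - a) (Num.min d1 d2) by rewrite !lt_min sa d10.
  have m1 : Num.min (s - a) (Num.min d1 d2) <= s - a by rewrite ge_min lexx.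
  have m2 : Num.min (s - a) (Num.min d1 d2) <= d1 by rewrite !ge_min lexx orbT.
  have m3 : Num.min (s - a) (Num.min d1 d2) <= d2 by rewrite !ge_min lexx !orbT.
  by rewrite /d; move: (Num.min _ _) m0 m1 m2 m3 => m *; split; lra.
have near_a x : a < x -> x <= a + d -> good x.
  by move=> ax xd; split; [apply: Hd1|apply: Hd2] => //; lra.
pose g x := Num.min (dot (u x) nu) (dot (u x) sigma).
have gP x : (0 < g x) <-> good x by rewrite /g lt_min; split=> /andP.
have cg : continuous g by apply: cont_min; exact: cu.
have ad_s : a + d <= s by lra.
have gad : 0 < g (a + d) by apply/gP/near_a; lra.
have [H|[t1 [adt1 t1s gt1 H]]] := first_exit ad_s cg gad.
  by apply/gP; apply: H.
have : good t1.
  apply: formulas_good; [lra|lra|apply: good_formulas; first lra].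
  move=> x ax xt; have [xd|dx] := leP x (a + d); first exact: near_a.
  by apply/gP; apply: H => //; exact: ltW.
by move=> /gP; rewrite gt1 ltxx.
Qed.

End face_phase.

(** * Crossing the normal cone of the vertex *)

(** A particle that starts from [(eps, 0)] with velocity [(0, D)] reaches the
    boundary of the normal cone after the time [eps * tan theta / D]; twice that
    time is a safe bound for the perturbed motion. *)
Definition crossing_rate (R : realType) (theta D : R) : R :=
  2 * sin theta / (D * cos theta).

(** The factor by which the bound [e] on the perturbation at the entrance grows
    during the crossing: a force at most
    [4 alpha D sqrt k + 2 k (1 + D H) eps] acts during a time at most
    [H eps], where [H] is [crossing_rate theta D] and [sqrt k eps <= e]. *)
Definition velocity_drift (R : realType) (theta alpha D : R) : R :=
  2 + crossing_rate theta D * (4 * alpha * D + 2 + 2 * D * crossing_rate theta D).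

Section corner_phase.
Variables (R : realType) (theta alpha k : R) (u v : R -> 'rV[R]_2).
Hypothesis mo : motion theta alpha k u v.
Let x t := u t 0 0. Let y t := u t 0 1.
Let p t := v t 0 0. Let q t := v t 0 1.
Let s := sin theta. Let c := cos theta.
Variables (t0 D e eps : R).
Let H := crossing_rate theta D.
Let C := velocity_drift theta alpha D.
Let d := C * e.
Hypotheses (s0 : 0 < s) (c0 : 0 < c) (t00 : 0 < t0) (alpha0 : 0 < alpha) (k1 : 1 <= k)
  (D0 : 0 < D) (e0 : 0 < e) (e1 : e <= 1) (dD : d <= D * c / 8)
  (epsE : x t0 = eps) (eps0 : 0 < eps) (epse : Num.sqrt k * eps <= e)
  (y0 : y t0 = 0) (p0 : `|p t0| <= e) (q0 : q t0 = D).
Let eta := H * eps.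

Let xE : x = fun t => dot (u t) (vec2 1 0).
Proof. by apply/funext => t; rewrite dot_vec2 mulr1 mulr0 addr0. Qed.
Let yE : y = fun t => dot (u t) (vec2 0 1).
Proof. by apply/funext => t; rewrite dot_vec2 mulr1 mulr0 add0r. Qed.
Let pE : p = fun t => dot (v t) (vec2 1 0).
Proof. by apply/funext => t; rewrite dot_vec2 mulr1 mulr0 addr0. Qed.
Let qE : q = fun t => dot (v t) (vec2 0 1).
Proof. by apply/funext => t; rewrite dot_vec2 mulr1 mulr0 add0r. Qed.

Let cx : continuous x. Proof. by rewrite xE; apply: cont_dot; exact: motion_cont mo. Qed.
Let cy : continuous y. Proof. by rewrite yE; apply: cont_dot; exact: motion_cont mo. Qed.
Let cp : continuous p.
Proof. by rewrite pE; apply: cont_dot; exact: motion_cont_velocity mo. Qed.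
Let cq : continuous q.
Proof. by rewrite qE; apply: cont_dot; exact: motion_cont_velocity mo. Qed.

Let dx (t : R) : 0 < t -> is_derive t 1 x (p t).
Proof. by rewrite xE pE; exact: (motion_derive_dot mo). Qed.
Let dy (t : R) : 0 < t -> is_derive t 1 y (q t).
Proof. by rewrite yE qE; exact: (motion_derive_dot mo). Qed.

Let F t := 2 * alpha * Num.sqrt k * ((p t * x t + q t * y t) / (x t * x t + y t * y t)) + k.

Lemma corner_acceleration (t : R) : 0 < t ->
  0 < x t -> 0 < y t -> 0 < x t * s - y t * c ->
  is_derive t 1 v (- F t *: u t).
Proof.
move=> t_gt0 xt yt ht.
have N0 : x t * x t + y t * y t != 0 by apply: lt0r_neq0; nra.
have c1 : continuous (fun t => p t * x t + q t * y t).
  by apply: cont_add; apply: cont_mul.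
have c2 : continuous (fun t => x t * x t + y t * y t).
  by apply: cont_add; apply: cont_mul.
have cF : {for t, continuous F}.
  have c3 := cvgM (c1 t) (cvgV N0 (c2 t)).
  suff : F z @[z --> t] --> F t by [].
  rewrite {1}/F; apply: (@cvgD _ R _ _ _ _ (fun=> k)); last exact: cvg_cst.
  apply: (@cvgM R _ _ _ (fun=> 2 * alpha * Num.sqrt k)); first exact: cvg_cst.
  exact: c3.
apply: (motion_acceleration (f := fun t => - F t *: u t) mo t_gt0).
  by apply: cvgZ; [apply: cvgN; exact: cF|exact: (motion_cont mo)].
have [d1 d10 Hd1] := continuous_gt0_near cx xt.
have [d2 d20 Hd2] := continuous_gt0_near cy yt.
have ch : continuous (fun t => x t * s - y t * c).
  by apply: cont_sub; apply: cont_mul => //; exact: cont_cst.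
have [d3 d30 Hd3] := continuous_gt0_near ch ht.
apply/nbhs_ballP; exists (Num.min d1 (Num.min d2 d3)) => /=.
  by rewrite !lt_min d10 d20.
move=> r; rewrite /ball/= distrC !lt_min => /and3P[sd1 sd2 sd3].
rewrite (@acceleration_corner R theta alpha k (u r) (v r)) //.
- by rewrite !dotE.
- exact: Hd1.
- exact/ltW/Hd2.
- by rewrite -subr_ge0; exact/ltW/Hd3.
Qed.

(** The damping force is proportional to the radial part of the velocity, so that
    it is bounded whatever the position; this is what makes it harmless near the vertex,
    where it is discontinuous. *)
Let radial_bound (a b P Q : R) : 0 < a * a + b * b ->
  `|(P * a + Q * b) / (a * a + b * b) * a| <= `|P| + `|Q| /\
  `|(P * a + Q * b) / (a * a + b * b) * b| <= `|P| + `|Q|.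
Proof.
move=> N0.
have aux z : `|z| ^+ 2 <= a * a + b * b ->
    `|(P * a + Q * b) / (a * a + b * b) * z| <= `|P| + `|Q|.
  move=> Hz.
  rewrite mulrAC normrM normfV [X in _ / X]gtr0_norm// ler_pdivrMr// normrM.
  have : `|P * a + Q * b| <= `|P| * `|a| + `|Q| * `|b|.
    by rewrite (le_trans (ler_normD _ _))// !normrM.
  have := real_normK (num_real a); have := real_normK (num_real b).
  move: (normr_ge0 P) (normr_ge0 Q) (normr_ge0 a) (normr_ge0 b) (normr_ge0 z) Hz.
  rewrite -!expr2 => P0 Q0 a0 b0 z0 Hz hb ha Hle.
  rewrite -ha -hb in Hz *.
  apply: le_trans (ler_wpM2r z0 Hle) _.
  have az : `|a| * `|z| <= `|a| ^+ 2 + `|b| ^+ 2 by nra.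
  have bz : `|b| * `|z| <= `|a| ^+ 2 + `|b| ^+ 2 by nra.
  rewrite !mulrDl -!mulrA; apply: lerD; exact: ler_wpM2l.
by split; apply: aux; rewrite real_normK ?num_real// expr2; nra.
Qed.

Let H0 : 0 < H. Proof. by rewrite divr_gt0 ?mulr_gt0. Qed.
Let C_gt2 : 2 < C.
Proof.
have [s0_ c0_ t0_ a0_] := And4 s0 c0 t00 alpha0; have [k1_ D0_ e0_ e1_ dD_] := And5 k1 D0 e0 e1 dD.
have aD : 0 < alpha * D by rewrite mulr_gt0.
have DH : 0 < D * H by rewrite mulr_gt0.
by rewrite /C /velocity_drift -/H ltrDl mulr_gt0//; lra.
Qed.
Let d0 : 0 < d. Proof. by rewrite mulr_gt0//; have := C_gt2; lra. Qed.
Let eta0 : 0 < eta. Proof. by rewrite mulr_gt0. Qed.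
Let HDc : H * D * c = 2 * s.
Proof. by rewrite /H /crossing_rate -/s -/c; field; rewrite !gt_eqF. Qed.
Let c1 : c <= 1. Proof. exact: cos_le1. Qed.
Let s1 : s <= 1. Proof. exact: sin_le1. Qed.
Let dD8 : d <= D / 8. Proof. have := dD; have : D * c <= D by [rewrite ger_pMr]; lra. Qed.
(* The horizontal displacement during the crossing is a fraction of [eps]. *)
Let deta : d * eta <= eps * s / 4.
Proof.
have E : D * c / 8 * eta = eps * s / 4.
  have -> : D * c / 8 * eta = H * D * c * (eps / 8) by rewrite /eta; field.
  by rewrite HDc; field.
by rewrite -E ler_wpM2r// ltW.
Qed.

Let M := 4 * alpha * Num.sqrt k * D + 2 * k * (1 + D * H) * eps.

Let Meta : M * eta <= (C - 2) * e.
Proof.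
have [s0_ c0_ t0_ a0_] := And4 s0 c0 t00 alpha0; have [k1_ D0_ e0_ e1_ dD_] := And5 k1 D0 e0 e1 dD.
have [eps0_ epse_ c1_ s1_] := And4 eps0 epse c1 s1.
have [C2_ H0_ d0_ eta0_ dD8_] := And5 C_gt2 H0 d0 eta0 dD8; have deta_ := deta.
have k0 : 0 < k by lra.
have sk0 : 0 < Num.sqrt k by rewrite sqrtr_gt0.
have -> : M * eta = H * (4 * alpha * D * (Num.sqrt k * eps) +
   2 * (1 + D * H) * (Num.sqrt k * eps) ^+ 2).
  by rewrite exprMn sqr_sqrtr ?ltW// /M /eta; ring.
have -> : (C - 2) * e = H * (4 * alpha * D * e + 2 * (1 + D * H) * e).
  by rewrite /C /velocity_drift -/H; ring.
have w0 : 0 <= Num.sqrt k * eps by rewrite mulr_ge0 ?ltW.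
rewrite ler_wpM2l ?(ltW H0)//; apply: lerD.
  by rewrite ler_wpM2l// ltW// !mulr_gt0.
rewrite ler_wpM2l//.
  by rewrite ltW// !mulr_gt0// addr_gt0// mulr_gt0.
by move: epse; nra.
Qed.

Let h t := x t * s - y t * c.
Let g t := Num.min (Num.min (d - `|p t|) (d - `|q t - D|)) (h t).

Let gP t : 0 < g t <-> [/\ `|p t| < d, `|q t - D| < d & 0 < h t].
Proof.
by rewrite /g !lt_min !subr_gt0; split=> [/andP[/andP[]]//|[-> -> ->]].
Qed.

(** Bootstrap: as long as the velocity is within [d] of [(0, D)] and the
    particle is in the normal cone, the impulse is so small that the velocity
    is strictly within [d]. *)
Let estimate t : t0 <= t -> t <= t0 + eta ->
  (forall r, t0 <= r -> r < t -> 0 < g r) ->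
  [/\ `|p t| < d, `|q t - D| < d, `|x t - eps| <= d * (t - t0) &
      `|y t - D * (t - t0)| <= d * (t - t0)].
Proof.
have [s0_ c0_ t0_ a0_] := And4 s0 c0 t00 alpha0; have [k1_ D0_ e0_ e1_ dD_] := And5 k1 D0 e0 e1 dD.
have [eps0_ epse_ c1_ s1_] := And4 eps0 epse c1 s1.
have [C2_ H0_ d0_ eta0_ dD8_] := And5 C_gt2 H0 d0 eta0 dD8; have deta_ := deta.
move=> tt te gt.
have tpos r : t0 < r -> 0 < r by exact: lt_trans.
have xb r : t0 <= r -> r <= t -> `|x r - eps| <= d * (r - t0).
  move=> tr rt; have := @MVT_bound R x p t0 r 0 d tr cx.
  rewrite mul0r subr0 epsE; apply=> z z1 z2; first exact/dx/tpos.
  by rewrite subr0; have [/gP[/ltW]] := gt z (ltW z1) (lt_le_trans z2 rt).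
have yb r : t0 <= r -> r <= t -> `|y r - D * (r - t0)| <= d * (r - t0).
  move=> tr rt; have := @MVT_bound R y q t0 r D d tr cy.
  rewrite y0 subr0; apply=> z z1 z2; first exact/dy/tpos.
  by have [/gP[_ /ltW]] := gt z (ltW z1) (lt_le_trans z2 rt).
have inside r : t0 < r -> r < t -> [/\ 0 < x r, x r <= 2 * eps, 0 < y r,
    y r <= 2 * D * H * eps & is_derive r 1 v (- F r *: u r)].
  move=> tr rt; have := xb r (ltW tr) (ltW rt); have := yb r (ltW tr) (ltW rt).
  have dr : d * (r - t0) <= eps * s / 4.
    by apply: le_trans deta; rewrite ler_wpM2l ?(ltW d0)//; lra.
  rewrite !ler_norml => /andP[y1 y2] /andP[x1 x2].
  have xr0 : 0 < x r by nra.
  have yr0 : 0 < y r by have : 0 < r - t0 by [lra]; nra.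
  split => //; [nra| |].
    have : D * (r - t0) <= D * eta by rewrite ler_wpM2l ?(ltW D0)//; lra.
    have : d * (r - t0) <= D / 8 * eta.
      by apply: ler_pM => //; rewrite ?(ltW d0)//; lra.
    have : 0 < D * eta by rewrite mulr_gt0.
    by rewrite /eta; lra.
  apply: corner_acceleration => //; first exact: tpos.
  by have [/gP[]] := gt r (ltW tr) rt.
have k0 : 0 < k by lra.
have sk0 : 0 < Num.sqrt k by rewrite sqrtr_gt0.
have acc r : t0 < r -> r < t ->
  `|- F r * x r| <= M /\ `|- F r * y r| <= M.
  move=> tr rt; have [x1 x2 y1 y2 _] := inside r tr rt.
  have N0 : 0 < x r * x r + y r * y r by nra.
  have [bx by_] := radial_bound (p r) (q r) N0.
  have pq : `|p r| + `|q r| <= 2 * D.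
    have [/gP[p1 q1 _]] := gt r (ltW tr) rt.
    have : `|q r| <= `|q r - D| + D.
      by rewrite -{1}(subrK D (q r)) (le_trans (ler_normD _ _))// (gtr0_norm D0).
    by lra.
  have split_acc z w : 0 < z -> z <= 2 * (1 + D * H) * eps ->
      `|w * z| <= `|p r| + `|q r| ->
      `|- (2 * alpha * Num.sqrt k * w + k) * z| <= M.
    move=> z0 z1 wz; rewrite mulNr normrN mulrDl.
    rewrite (le_trans (ler_normD _ _))// /M lerD//.
      rewrite -[_ * w * z]mulrA normrM gtr0_norm ?mulr_gt0//.
      have -> : 4 * alpha * Num.sqrt k * D = 2 * alpha * Num.sqrt k * (2 * D) by ring.
      by rewrite ler_wpM2l ?(le_trans wz)// ltW// !mulr_gt0.
    rewrite gtr0_norm ?mulr_gt0//.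
    have -> : 2 * k * (1 + D * H) * eps = k * (2 * (1 + D * H) * eps) by ring.
    by rewrite ler_wpM2l// ltW.
  have DH0 : 0 < D * H * eps by rewrite mulr_gt0// mulr_gt0.
  by split; apply: split_acc => //; lra.
have vb : `|p t - p t0| <= M * (t - t0) /\ `|q t - q t0| <= M * (t - t0).
  split.
    have := @MVT_bound R p (fun r => - F r * x r) t0 t 0 M tt cp.
    rewrite mul0r subr0; apply=> z z1 z2; last by rewrite subr0; exact: (acc z z1 z2).1.
    have [_ _ _ _ dv] := inside z z1 z2.
    have := is_derive_dot (vec2 1 0) dv.
    by rewrite -[X in is_derive _ _ X _]pE dotZl dot_vec2 mulr1 mulr0 addr0.
  have := @MVT_bound R q (fun r => - F r * y r) t0 t 0 M tt cq.
  rewrite mul0r subr0; apply=> z z1 z2; last by rewrite subr0; exact: (acc z z1 z2).2.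
  have [_ _ _ _ dv] := inside z z1 z2.
  have := is_derive_dot (vec2 0 1) dv.
  by rewrite -[X in is_derive _ _ X _]qE dotZl dot_vec2 mulr1 mulr0 add0r.
have Mt : M * (t - t0) <= (C - 2) * e.
  apply: le_trans Meta; rewrite ler_wpM2l//; last by lra.
  by rewrite /M addr_ge0// ltW// !mulr_gt0// addr_gt0// mulr_gt0.
have [vb1 vb2] := vb.
split; [|by rewrite -q0 (le_lt_trans vb2)// (le_lt_trans Mt)// /d; lra|exact: xb|exact: yb].
rewrite -(subrK (p t0) (p t)) (le_lt_trans (ler_normD _ _))//.
by move: p0; rewrite /d; lra.
Qed.

(** By [estimate] the velocity cannot be the cause of a first exit, and the
    particle cannot remain in the normal cone up to the time [t0 + eta], so it
    exits through the boundary of the second face. *)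
Lemma corner_phase : exists t1, [/\ t0 < t1, t1 <= t0 + eta,
  y t1 * c = x t1 * s, 0 < x t1 &
  forall t, t0 <= t -> t <= t1 ->
    [/\ `|p t| <= d, `|q t - D| <= d, `|x t| <= 2 * eps & `|y t| <= 2 * D * H * eps]].
Proof.
have [s0_ c0_ t0_ a0_] := And4 s0 c0 t00 alpha0; have [k1_ D0_ e0_ e1_ dD_] := And5 k1 D0 e0 e1 dD.
have [eps0_ epse_ c1_ s1_] := And4 eps0 epse c1 s1.
have [C2_ H0_ d0_ eta0_ dD8_] := And5 C_gt2 H0 d0 eta0 dD8; have deta_ := deta.
have cg : continuous g.
  apply: cont_min; last by apply: cont_sub; apply: cont_mul => //; exact: cont_cst.
  apply: cont_min; apply: cont_sub; try exact: cont_cst; apply: cont_norm => //.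
  by apply: cont_sub => //; exact: cont_cst.
have g0 : 0 < g t0.
  apply/gP; rewrite q0 subrr normr0 /h y0 epsE mul0r subr0; split; [|exact: d0|exact: mulr_gt0].
  by rewrite (le_lt_trans p0)// /d; have := C_gt2; nra.
have te : t0 <= t0 + eta by rewrite lerDl ltW.
have bnd t : t0 <= t -> t <= t0 + eta ->
  (forall r, t0 <= r -> r < t -> 0 < g r) ->
  [/\ 0 < x t, `|x t| <= 2 * eps & `|y t| <= 2 * D * H * eps].
  move=> t1 t2 /(estimate t1 t2)[_ _]; rewrite !ler_norml => /andP[x1 x2] /andP[y1 y2].
  have dr : d * (t - t0) <= eps * s / 4.
    by apply: le_trans deta; rewrite ler_wpM2l ?(ltW d0)//; lra.
  have Dt : D * (t - t0) <= D * eta by rewrite ler_wpM2l ?(ltW D0)//; lra.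
  have dt : d * (t - t0) <= D / 8 * (t - t0).
    by apply: ler_wpM2r => //; lra.
  have Dt0 : 0 <= D * (t - t0) by rewrite mulr_ge0 ?(ltW D0)//; lra.
  have es : 0 < eps * s by rewrite mulr_gt0.
  have es1 : eps * s <= eps by rewrite ger_pMr.
  by split; [lra|apply/andP; split; lra|apply/andP; rewrite /eta in Dt; split; lra].
have [Hall|[t1 [t01 t1e gt1 Ht1]]] := first_exit te cg g0.
  have [_ _] := estimate te (lexx _) (fun r r1 r2 => Hall r r1 (ltW r2)).
  rewrite addrAC subrr add0r !ler_norml => /andP[_ x2] /andP[y1 _].
  have [/gP[_ _]] := Hall _ te (lexx _); rewrite /h.
  have E : D * eta * c = 2 * s * eps by rewrite /eta -HDc; ring.
  have es : 0 < eps * s by rewrite mulr_gt0.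
  have A : x (t0 + eta) * s <= (eps + d * eta) * s by rewrite ler_wpM2r ?(ltW s0)//; lra.
  have B : (D * eta - d * eta) * c <= y (t0 + eta) * c.
    by rewrite ler_wpM2r ?(ltW c0)//; lra.
  have de0 : 0 <= d * eta by rewrite mulr_ge0 ?ltW.
  have A' : d * eta * s <= d * eta by rewrite ger_pMr// mulr_gt0.
  have B' : d * eta * c <= d * eta by rewrite ger_pMr// mulr_gt0.
  by have := deta; lra.
have est t : t0 <= t -> t <= t1 ->
    (forall r, t0 <= r -> r < t -> 0 < g r) by move=> ? tt r r1 r2; apply: Ht1 => //; lra.
have t01' := ltW t01.
have [x1 _ _] := bnd _ t01' t1e (est _ t01' (lexx _)).
exists t1; split => //.
- have [p1 q1 _ _] := estimate t01' t1e (est _ t01' (lexx _)).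
  have h1 : h t1 <= 0.
    rewrite leNgt; apply/negP => h1.
    by have : 0 < g t1 by [apply/gP]; rewrite gt1 ltxx.
  have h2 : 0 <= h t1.
    rewrite -gt1 /g ge_min lexx orbT //.
  by apply/eqP; rewrite eq_sym -subr_eq0 eq_le h1 h2.
- move=> t tt0 tt1; have te1 : t <= t0 + eta by exact: le_trans t1e.
  have [p1 q1 _ _] := estimate tt0 te1 (est _ tt0 tt1).
  have [_ ? ?] := bnd _ tt0 te1 (est _ tt0 tt1).
  by split => //; exact: ltW.
Qed.

End corner_phase.

(** * Quantitative estimates outside a face *)

Section face_estimates.
Variables (R : realType) (theta alpha k : R) (u v : R -> 'rV[R]_2).
Hypothesis mo : motion theta alpha k u v.
Variables (nu sigma : 'rV[R]_2).
Hypothesis fc : face theta nu sigma.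
Variables (a b : R).
Hypotheses (a0 : 0 <= a) (alpha1 : 1 < alpha) (k0 : 0 < k).
Hypotheses (x0 : 0 <= dot (u a) nu) (v0 : 0 < dot (v a) nu).
Hypotheses (ys0 : 0 <= dot (u a) sigma)
  (ys1 : dot (u a) sigma = 0 -> 0 < dot (v a) sigma).
Hypothesis y0 : forall t, a < t -> t < b ->
  0 < dot (u a) sigma + (t - a) * dot (v a) sigma.

(** The characteristic roots are [- sqrt k * (alpha - root_gap)] and
    [- sqrt k * (alpha + root_gap)]. *)
Definition root_gap := Num.sqrt (alpha ^+ 2 - 1).
Let rho := root_gap.

Lemma root_gap_gt0 : 0 < rho.
Proof. by rewrite /rho sqrtr_gt0; have := alpha1; nra. Qed.

Lemma root_gap_sqr : rho ^+ 2 = alpha ^+ 2 - 1.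
Proof. by rewrite sqr_sqrtr//; have := alpha1; nra. Qed.

Lemma root_gap_lt : rho < alpha.
Proof. have := root_gap_sqr; have := root_gap_gt0; have := alpha1; nra. Qed.

Let q := Num.sqrt k.
Let q0 : 0 < q. Proof. by rewrite sqrtr_gt0. Qed.

(** Here [e1] and [e2] are the values of the slow and of the fast mode; the
    bound on [e1] is [expR (- w) <= w^-1]. *)
Lemma face_motion t : a <= t -> t <= b ->
  exists e1 e2, [/\ 0 < e2, e2 <= e1, e1 <= 1,
      a < t -> e2 < e1 /\ q * (alpha - rho) * (t - a) * e1 <= 1 &
   [/\ dot (v t) sigma = dot (v a) sigma,
     dot (u t) sigma = dot (u a) sigma + (t - a) * dot (v a) sigma,
     2 * rho * q * dot (u t) nu =
       (dot (v a) nu + q * (alpha + rho) * dot (u a) nu) * e1 -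
       (dot (v a) nu + q * (alpha - rho) * dot (u a) nu) * e2 &
     dot (v t) nu = (dot (v a) nu + q * (alpha - rho) * dot (u a) nu) * e2
        - q * (alpha - rho) * dot (u t) nu]].
Proof.
move=> at_ tb.
have [rho0 rhoa q_gt0] := And3 root_gap_gt0 root_gap_lt q0.
have r10 : 0 < q * (alpha - rho) by rewrite mulr_gt0// subr_gt0.
have r12 : q * (alpha - rho) < q * (alpha + rho) by rewrite ltr_pM2l//; lra.
have rD : q * (alpha - rho) + q * (alpha + rho) = 2 * alpha * Num.sqrt k.
  by rewrite -/q; ring.
have rM : q * (alpha - rho) * (q * (alpha + rho)) = k.
  have -> : q * (alpha - rho) * (q * (alpha + rho)) = q ^+ 2 * (alpha ^+ 2 - rho ^+ 2).
    by ring.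
  by rewrite root_gap_sqr sqr_sqrtr ?ltW//; ring.
have [f1 f2 f3 f4] := face_phase mo fc a0 r10 r12 rD rM x0 v0 ys0 ys1 y0 at_ tb.
have ta : 0 <= t - a by rewrite subr_ge0.
exists (expR (- (q * (alpha - rho)) * (t - a))), (expR (- (q * (alpha + rho)) * (t - a))).
split.
- exact: expR_gt0.
- by rewrite ler_expR !mulNr lerN2 ler_wpM2r// ltW.
- by rewrite -expR0 ler_expR mulNr oppr_le0 mulr_ge0// ltW.
- move=> at'; split; first by rewrite ltr_expR !mulNr ltrN2 ltr_pM2r ?subr_gt0.
  rewrite mulNr; have := expRN (q * (alpha - rho) * (t - a)) => ->.
  rewrite ler_pdivrMr ?expR_gt0// mul1r.
  by have := expR_ge1Dx (q * (alpha - rho) * (t - a)); lra.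
- split=> //.
    by rewrite -f3 -f4; ring.
  by rewrite -f3; ring.
Qed.

Lemma face_penetration t : a <= t -> t <= b ->
  0 <= dot (u t) nu <=
    (dot (v a) nu + q * (alpha + rho) * dot (u a) nu) / (2 * rho * q).
Proof.
move=> at_ tb; have [e1 [e2 [e20 e21 e11 _ [_ _ f _]]]] := face_motion at_ tb.
have [rho0 rhoa q_gt0] := And3 root_gap_gt0 root_gap_lt q0.
have rq : 0 < 2 * rho * q by rewrite !mulr_gt0.
have [v0' x0'] := conj v0 x0.
have A0 : 0 <= q * (alpha - rho) * dot (u a) nu by rewrite mulr_ge0// mulr_ge0//; lra.
have AB : q * (alpha - rho) * dot (u a) nu <= q * (alpha + rho) * dot (u a) nu.
  by rewrite ler_wpM2r// ler_wpM2l//; lra.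
rewrite ler_pdivlMr// [dot (u t) nu * _]mulrC f -(pmulr_rge0 _ rq) f.
have B1 : (dot (v a) nu + q * (alpha + rho) * dot (u a) nu) * e1 <=
     dot (v a) nu + q * (alpha + rho) * dot (u a) nu.
  by apply: ler_piMr => //; lra.
have B2 : 0 <= (dot (v a) nu + q * (alpha - rho) * dot (u a) nu) * e2.
  by apply: mulr_ge0; lra.
have B3 : (dot (v a) nu + q * (alpha - rho) * dot (u a) nu) * e2 <=
   (dot (v a) nu + q * (alpha + rho) * dot (u a) nu) * e1.
  by apply: ler_pM; lra.
by apply/andP; split; lra.
Qed.

(** For a trajectory that starts on the face, both modes have the same
    amplitude and everything is controlled by the slow one, which is at most
    [((alpha - rho) * (t - a))^-1 / sqrt k].  The power of [k] gained here is
    what makes the crossing at the vertex negligible. *)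
Lemma face_relaxation t : dot (u a) nu = 0 -> a < t -> t <= b ->
  [/\ 0 < dot (u t) nu,
      q * dot (u t) nu <= dot (v a) nu / (2 * rho) * (((alpha - rho) * (t - a))^-1 / q) &
      `|dot (v t) nu| <= dot (v a) nu * (1 + alpha / (2 * rho)) *
        (((alpha - rho) * (t - a))^-1 / q)].
Proof.
move=> ua at_ tb.
have [e1 [e2 [e20 e21 e11 /(_ at_)[e21' e1s] [_ _ f g]]]] := face_motion (ltW at_) tb.
have [rho0 rhoa q_gt0] := And3 root_gap_gt0 root_gap_lt q0.
have rq : 0 < 2 * rho * q by rewrite !mulr_gt0.
have v0' := v0.
have w0 : 0 < (alpha - rho) * (t - a) by rewrite mulr_gt0 ?subr_gt0.
have eW : e1 <= ((alpha - rho) * (t - a))^-1 / q.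
  by rewrite -invfM -[_^-1]mul1r ler_pdivlMr ?mulr_gt0//; move: e1s; nra.
rewrite ua !mulr0 !addr0 in f g.
have z0 : 0 < dot (u t) nu.
  by rewrite -(pmulr_rgt0 _ rq) f -mulrBr mulr_gt0// subr_gt0.
have z1 : q * dot (u t) nu <= dot (v a) nu / (2 * rho) * e1.
  have -> : q * dot (u t) nu = dot (v a) nu / (2 * rho) * (e1 - e2).
    have -> : q * dot (u t) nu = (2 * rho * q * dot (u t) nu) / (2 * rho).
      by field; lra.
    by rewrite f; field; lra.
  by rewrite ler_wpM2l ?divr_ge0//; lra.
have z2 : `|dot (v t) nu| <= dot (v a) nu * (1 + alpha / (2 * rho)) * e1.
  have -> : dot (v a) nu * (1 + alpha / (2 * rho)) * e1 =
     dot (v a) nu * e1 + alpha * (dot (v a) nu / (2 * rho) * e1) by field; lra.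
  rewrite g (le_trans (ler_normB _ _))// lerD//.
    by rewrite gtr0_norm ?mulr_gt0// ler_wpM2l// ltW.
  rewrite mulrAC [q * _ * _]mulrC gtr0_norm ?mulr_gt0// ?subr_gt0//.
  apply: ler_pM => //; [lra|by rewrite mulr_ge0// ltW|lra].
split=> //.
  by apply: le_trans z1 _; rewrite ler_wpM2l// divr_ge0//; lra.
apply: le_trans z2 _; rewrite ler_wpM2l// mulr_ge0 ?addr_ge0 ?divr_ge0//; lra.
Qed.

End face_estimates.

Section limit.
Variables (R : realType) (theta x2_0 dx1 D : R).

Lemma orth_proj_line1 (a b : R) : orth_proj (@line1 R) (vec2 a b) = vec2 0 b.
Proof.
apply: orth_projE; first by rewrite /line1/= vec2_0.
by move=> q q0; rewrite dotE !mxE/= q0; ring.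
Qed.

Lemma orth_proj_line2 (b : R) : orth_proj (line2 theta) (vec2 0 b) =
  (b * cos theta) *: vec2 (- sin theta) (cos theta).
Proof.
have cs := cos2Dsin2 theta.
apply: orth_projE; first by rewrite /line2/= !mxE/=; ring.
move=> q q0; rewrite dotE !mxE/=.
transitivity (b * sin theta * (q 0 0 * cos theta + q 0 1 * sin theta)).
  have -> : b - b * cos theta * cos theta = b * sin theta ^+ 2.
    by rewrite -[X in X - _]mulr1 -cs; ring.
  by ring.
by rewrite q0 mulr0.
Qed.

Lemma limit_motionE t0 t :
  limit_motion theta (vec2 0 x2_0) (vec2 dx1 D) t0 t =
  if t <= t0 then vec2 0 (x2_0 + t * D)
  else ((t - t0) * (D * cos theta)) *: vec2 (- sin theta) (cos theta).
Proof.
rewrite /limit_motion orth_proj_line1 orth_proj_line2 scalerA.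
case: ifP => // _; apply/rowP => i; rewrite !mxE.
by case: ifP => _; rewrite ?mulr0 ?addr0.
Qed.

End limit.

(** * The first and the last regime *)

Section phases.
Variables (R : realType) (theta alpha k : R) (u v : R -> 'rV[R]_2).
Hypothesis mo : motion theta alpha k u v.
Hypotheses (th0 : 0 < theta) (th1 : theta < pi / 2) (alpha1 : 1 < alpha) (k0 : 0 < k).
Let rho := root_gap alpha.
Let s := sin theta. Let c := cos theta.

Lemma sin_cone_gt0 : 0 < s.
Proof. by apply: sin_gt0_pi; have := pi_gt0 R; have := th1; have := th0; lra. Qed.

Lemma cos_cone_gt0 : 0 < c.
Proof. by apply: cos_gt0_pihalf; have := pi_gt0 R; have := th1; have := th0; lra. Qed.

(** The first regime: [nu = (1, 0)], and [sigma = (0, -1)] points downwards: the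
    tangential coordinate decreases, and vanishes at [t0]. *)
Lemma contact_phase (x2_0 dx1 D : R) (t0 := - x2_0 / D)
    (kappa := ((alpha - rho) * t0)^-1) :
  x2_0 < 0 -> 0 < dx1 -> 0 < D ->
  u 0 = vec2 0 x2_0 -> v 0 = vec2 dx1 D ->
  (forall t, 0 <= t -> t <= t0 -> u t 0 1 = x2_0 + t * D /\
    0 <= u t 0 0 <= dx1 / (2 * rho * Num.sqrt k)) /\
  [/\ v t0 0 1 = D, 0 < u t0 0 0,
    Num.sqrt k * u t0 0 0 <= dx1 / (2 * rho) * (kappa / Num.sqrt k) &
    `|v t0 0 0| <= dx1 * (1 + alpha / (2 * rho)) * (kappa / Num.sqrt k)].
Proof.
move=> x20 dx10 D0 u0 v0.
have t00 : 0 < t0 by rewrite /t0 divr_gt0// oppr_gt0.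
have fc := face_line1 th0 th1.
have nuE z : dot z (vec2 1 0) = z 0 0 :> R by rewrite dot_vec2; ring.
have sgE z : dot z (vec2 0 (-1)) = - z 0 1 :> R by rewrite dot_vec2; ring.
have h1 : 0 <= dot (u 0) (vec2 1 0) by rewrite nuE u0 vec2_0.
have h2 : 0 < dot (v 0) (vec2 1 0) by rewrite nuE v0 vec2_0.
have h3 : 0 <= dot (u 0) (vec2 0 (-1)) by rewrite sgE u0 vec2_1; lra.
have h4 : dot (u 0) (vec2 0 (-1)) = 0 -> 0 < dot (v 0) (vec2 0 (-1)).
  by rewrite !sgE u0 v0 !vec2_1; lra.
have h5 t : 0 < t -> t < t0 ->
    0 < dot (u 0) (vec2 0 (-1)) + (t - 0) * dot (v 0) (vec2 0 (-1)).
  rewrite !sgE u0 v0 !vec2_1 /t0 => _; rewrite ltr_pdivlMr//; lra.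
split=> [t t1 t2|].
  have [e1 [e2 [_ _ _ _ [_ f _ _]]]] := face_motion mo fc (lexx 0) alpha1 k0 h1 h2 h3 h4 h5 t1 t2.
  have := face_penetration mo fc (lexx 0) alpha1 k0 h1 h2 h3 h4 h5 t1 t2.
  rewrite !nuE u0 v0 !vec2_0 mulr0 addr0 => ->; split=> //.
  by move: f; rewrite !sgE u0 v0 !vec2_1; lra.
have [e1 [e2 [_ _ _ _ [f _ _ _]]]] :=
  face_motion mo fc (lexx 0) alpha1 k0 h1 h2 h3 h4 h5 (ltW t00) (lexx t0).
have ua : dot (u 0) (vec2 1 0) = 0 by rewrite nuE u0 vec2_0.
have := face_relaxation mo fc (lexx 0) alpha1 k0 h1 h2 h3 h4 h5 ua t00 (lexx t0).
rewrite !nuE v0 !vec2_0 subr0 => -[g1 g2 g3].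
split=> //.
by move: f; rewrite !sgE v0 !vec2_1; lra.
Qed.

(** The last regime starts on the ray from the vertex along the second normal,
    with a tangential velocity pointing away from the vertex, hence it never
    ends. *)
Lemma slide_phase (t1 D d : R) (q := Num.sqrt k) : 0 < D -> 0 <= t1 ->
  u t1 0 1 * c = u t1 0 0 * s -> 0 < u t1 0 0 ->
  `|v t1 0 0| <= d -> `|v t1 0 1 - D| <= d -> d <= D * c / 8 -> d <= D * s / 8 ->
  exists2 W, `|W - D * c| <= 2 * d &
  forall t, t1 <= t -> exists2 z,
    0 <= z <= (2 * D + 2 * alpha * q * (u t1 0 0 + u t1 0 1)) / (2 * rho * q) &
    u t = z *: vec2 c s + ((t - t1) * W) *: vec2 (- s) c.
Proof.
move=> D0 t10 ut ux p1 q1 dc ds.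
have [s0 c0 k0' th0' th1'] := And5 sin_cone_gt0 cos_cone_gt0 k0 th0 th1.
have alpha1' := alpha1.
have s1 : s <= 1 by exact: sin_le1.
have c1 : c <= 1 by exact: cos_le1.
have fc := face_line2 th0 th1.
rewrite -/s -/c in fc.
have uy : 0 < u t1 0 1 by rewrite -(pmulr_lgt0 _ c0) ut mulr_gt0.
move: p1 q1; rewrite !ler_norml => /andP[p1 p2] /andP[q1 q2].
have nuE z : dot z (vec2 c s) = z 0 0 * c + z 0 1 * s :> R by rewrite dot_vec2.
have sgE z : dot z (vec2 (- s) c) = z 0 1 * c - z 0 0 * s :> R.
  by rewrite dot_vec2; ring.
have Ds1 : D * s <= D by rewrite ger_pMr.
have Dc1 : D * c <= D by rewrite ger_pMr.
have Ds0 : 0 < D * s by rewrite mulr_gt0.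
have Dc0 : 0 < D * c by rewrite mulr_gt0.
have d0 : 0 <= d by lra.
have bnd a x : 0 < a -> a <= 1 -> - d <= x -> x <= d -> - d <= x * a /\ x * a <= d.
  by move=> *; split; nra.
have [pc1 pc2] := bnd _ _ c0 c1 p1 p2; have [ps1 ps2] := bnd _ _ s0 s1 p1 p2.
have [qc1 qc2] := bnd _ _ c0 c1 q1 q2; have [qs1 qs2] := bnd _ _ s0 s1 q1 q2.
have h1 : 0 <= dot (u t1) (vec2 c s).
  by rewrite nuE addr_ge0// ltW// mulr_gt0.
have h2 : 0 < dot (v t1) (vec2 c s) by rewrite nuE; lra.
have h3' : dot (u t1) (vec2 (- s) c) = 0 by rewrite sgE ut subrr.
have h3 : 0 <= dot (u t1) (vec2 (- s) c) by rewrite h3'.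
have h4' : 0 < dot (v t1) (vec2 (- s) c) by rewrite sgE; lra.
have h5 b t : t1 < t -> t < b ->
    0 < dot (u t1) (vec2 (- s) c) + (t - t1) * dot (v t1) (vec2 (- s) c).
  by move=> tt _; rewrite h3' add0r mulr_gt0// subr_gt0.
exists (dot (v t1) (vec2 (- s) c)).
  by rewrite sgE ler_norml; apply/andP; split; lra.
move=> t tt.
have [e1 [e2 [_ _ _ _ [_ f _ _]]]] :=
  face_motion mo fc t10 alpha1 k0 h1 h2 h3 (fun=> h4') (@h5 t) tt (lexx t).
have := face_penetration mo fc t10 alpha1 k0 h1 h2 h3 (fun=> h4') (@h5 t) tt (lexx t).
move=> /andP[z0 z1].
exists (dot (u t) (vec2 c s)).
  rewrite z0/=; apply: le_trans z1 _.
  have rho0 : 0 < rho by exact: root_gap_gt0.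
  have rhoa : rho < alpha by exact: root_gap_lt.
  have q0 : 0 < q by rewrite /q sqrtr_gt0.
  have rq : 0 < 2 * rho * q by rewrite mulr_gt0// mulr_gt0.
  rewrite ler_pM2r ?invr_gt0//.
  rewrite lerD//; first by rewrite nuE; lra.
  have n1 : dot (u t1) (vec2 c s) <= u t1 0 0 + u t1 0 1.
    by rewrite nuE lerD// ger_pMr.
  rewrite -/rho -/q; apply: ler_pM => //; first by apply: mulr_ge0; [exact: ltW|lra].
  by rewrite mulrC ler_pM2r//; lra.
have [_ dec _ _ _] := fc.
by rewrite {1}(dec (u t)) f h3' add0r.
Qed.

End phases.

(** * Convergence *)

Section tracking.
Variables (R : realType) (theta : R).
Let s := sin theta. Let c := cos theta.

Lemma corner_tracking (m B X Y : R) (a : 'rV[R]_2) : 0 <= m -> m <= B ->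
  `|a 0 0| <= X -> `|a 0 1| <= Y -> `|m *: vec2 (- s) c - a| <= X + Y + B.
Proof.
move=> m0 mB aX aY.
have X0 : 0 <= X := le_trans (normr_ge0 _) aX.
have Y0 : 0 <= Y := le_trans (normr_ge0 _) aY.
have comp w A : `|w| <= 1 -> `|A| <= X + Y -> `|m * w - A| <= X + Y + B.
  move=> w1 AXY; rewrite (le_trans (ler_normB _ _))// addrC lerD//.
  by rewrite normrM (ger0_norm m0) (le_trans _ mB)// ler_piMr.
apply: rV2_norm_le; rewrite !mxE/=; apply: comp.
- by rewrite normrN ler_norml sin_geN1 sin_le1.
- by rewrite (le_trans aX)// lerDl.
- by rewrite ler_norml cos_geN1 cos_le1.
- by rewrite (le_trans aY)// lerDr.
Qed.

Lemma slide_tracking (z m m' : R) : 0 <= z ->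
  `|m' *: vec2 (- s) c - (z *: vec2 c s + m *: vec2 (- s) c)| <= z + `|m - m'|.
Proof.
move=> z0.
have comp w1 w2 : `|w1| <= 1 -> `|w2| <= 1 ->
    `|m' * w2 - (z * w1 + m * w2)| <= z + `|m - m'|.
  move=> Hw1 Hw2.
  have -> : m' * w2 - (z * w1 + m * w2) = - (z * w1 + (m - m') * w2) by ring.
  rewrite normrN (le_trans (ler_normD _ _))// !normrM (ger0_norm z0).
  by rewrite lerD// ler_piMr.
have ns : `|s| <= 1 by rewrite ler_norml sin_geN1 sin_le1.
have nc : `|c| <= 1 by rewrite ler_norml cos_geN1 cos_le1.
by apply: rV2_norm_le; rewrite !mxE/=; apply: comp; rewrite ?normrN.
Qed.

End tracking.

(** The four terms are the penetration in the first regime, the size of the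
    crossing region, the penetration in the last regime, and the error on the
    starting time and on the speed of the last regime. *)
Lemma tracking_error (R : realType) (theta alpha k x2_0 dx1 D T e : R)
    (u v : R -> 'rV[R]_2) (t0 := - x2_0 / D) (rho := root_gap alpha)
    (kappa := ((alpha - rho) * t0)^-1) (q := Num.sqrt k)
    (H := crossing_rate theta D) (C1 := velocity_drift theta alpha D)
    (Z := 2 * D + 4 * alpha * (1 + D * H)) :
  motion theta alpha k u v -> u 0 = vec2 0 x2_0 -> v 0 = vec2 dx1 D ->
  0 < theta -> theta < pi / 2 -> 1 < alpha -> x2_0 < 0 -> 0 < dx1 -> 0 < D ->
  1 <= k -> 0 < e -> e <= 1 ->
  C1 * e <= D * cos theta / 8 -> C1 * e <= D * sin theta / 8 ->
  dx1 / (2 * rho) * (kappa / q) <= e ->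
  dx1 * (1 + alpha / (2 * rho)) * (kappa / q) <= e ->
  forall t, 0 <= t -> t <= T ->
  `|limit_motion theta (vec2 0 x2_0) (vec2 dx1 D) t0 t - u t| <=
    dx1 / (2 * rho * q) + (2 + 3 * (D * H)) * e + Z / (2 * rho * q) +
    (2 * T * C1 + D * H) * e.
Proof.
move=> mo u00 v00 th0 th1 alpha1 x20 dx10 D0 k1 e0 e1 dc ds Eae Ebe t tt tT.
have s0 := sin_cone_gt0 th0 th1.
have c0 := cos_cone_gt0 th0 th1.
have rho0 : 0 < rho := root_gap_gt0 alpha1.
have k0 : 0 < k := lt_le_trans ltr01 k1.
have alpha0 : 0 < alpha := lt_trans ltr01 alpha1.
have q0 : 0 < q by rewrite sqrtr_gt0.
have t00 : 0 < t0 by rewrite divr_gt0// oppr_gt0.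
have T0 : 0 <= T := le_trans tt tT.
have c1 := cos_le1 theta.
set s := sin theta in s0 ds *.
set c := cos theta in c0 c1 dc *.
have H0 : 0 < H by rewrite divr_gt0 ?mulr_gt0.
have DH : 0 < D * H by rewrite mulr_gt0.
have Dc : 0 < D * c by rewrite mulr_gt0.
have [con [vy0 ux0 qux vx0]] := contact_phase mo th0 th1 alpha1 k0 x20 dx10 D0 u00 v00.
rewrite -/t0 -/rho -/kappa -/q in con vy0 ux0 qux vx0.
have uy0 : u t0 0 1 = 0.
  by have [-> _] := con t0 (ltW t00) (lexx _); rewrite /t0 divfK ?gt_eqF// subrr.
have [t1 [t01 t1e ut1 ux1 corner]] := corner_phase mo s0 c0 t00 alpha0 k1 D0 e0 e1
  dc erefl ux0 (le_trans qux Eae) uy0 (le_trans vx0 Ebe) vy0.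
rewrite -/H -/C1 -/s -/c in t1e ut1 corner.
set eps := u t0 0 0 in ux0 qux t1e corner.
have q1 : 1 <= q by rewrite -[leLHS]sqrtr1 ler_sqrt ?(ltW k0).
have epse : eps <= e.
  by apply: le_trans (le_trans qux Eae); rewrite ler_peMl// ltW.
have rq0 : 0 < 2 * rho * q by rewrite mulr_gt0// mulr_gt0.
have Ca' : 0 < dx1 / (2 * rho * q) by rewrite divr_gt0.
have Cb' : 0 < (2 + 3 * (D * H)) * e by rewrite mulr_gt0//; clear -DH; lra.
have Cc' : 0 < Z / (2 * rho * q).
  rewrite divr_gt0// /Z; have : 0 < alpha * (D * H) by rewrite mulr_gt0.
  by clear -D0 alpha0; lra.
have TC1 : 0 <= T * (C1 * e).
  have [p1 _ _ _] := corner t1 (ltW t01) (lexx _).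
  by rewrite mulr_ge0// (le_trans _ p1).
have Cd' : 0 < (2 * T * C1 + D * H) * e.
  have : 0 < D * H * e by rewrite mulr_gt0.
  by clear -TC1; lra.
have DHe : D * H * eps <= D * H * e by rewrite ler_pM2l.
rewrite limit_motionE -/c -/s.
have time_gap r : t0 <= r -> r <= t1 ->
    0 <= (r - t0) * (D * c) /\ (r - t0) * (D * c) <= D * H * e.
  move=> r0 r1; have rt : 0 <= r - t0 by rewrite subr_ge0.
  split; first by rewrite mulr_ge0// ltW.
  apply: le_trans DHe; have -> : D * H * eps = H * eps * D by ring.
  apply: ler_pM => //; [exact: ltW| |by rewrite ger_pMr].
  by rewrite lerBlDl (le_trans r1).
have [t_le|t_gt] := leP t t0.
  have [uy /andP[x1 x2]] := con t tt t_le.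
  apply: (@le_trans _ _ (dx1 / (2 * rho * q))); last by clear -Cb' Cc' Cd'; lra.
  apply: rV2_norm_le; rewrite !mxE/= ?uy.
    by rewrite sub0r normrN ger0_norm.
  by rewrite subrr normr0 (le_trans x1).
have [t_le1|t_gt1] := leP t t1.
  have [_ _ x1 y1] := corner t (ltW t_gt) t_le1.
  have [W0 W1] := time_gap t (ltW t_gt) t_le1.
  apply: le_trans (corner_tracking theta W0 W1 x1 y1) _.
  by clear -Ca' Cc' Cd' epse DHe; lra.
have [px1 qx1 x1 y1] := corner t1 (ltW t01) (lexx _).
have [W Wb sl] := slide_phase mo th0 th1 alpha1 k0 D0 (ltW (lt_trans t00 t01))
  ut1 ux1 px1 qx1 dc ds.
have [z /andP[z0 z1] uz] := sl t (ltW t_gt1).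
rewrite -/rho -/q -/c -/s in z1 uz.
have zZ : z <= Z / (2 * rho * q).
  apply: le_trans z1 _.
  have rq : 0 < (2 * rho * q)^-1 by rewrite invr_gt0.
  rewrite (ler_pM2r rq) lerD2l.
  have xy : u t1 0 0 + u t1 0 1 <= 2 * (1 + D * H) * eps.
    have := le_trans (ler_norm _) x1; have := le_trans (ler_norm _) y1.
    by clear; lra.
  have aq : 0 < 2 * alpha * q by apply: mulr_gt0 => //; exact: mulr_gt0.
  apply: (@le_trans _ _ (2 * alpha * q * (2 * (1 + D * H) * eps))).
    by rewrite ler_pM2l.
  have -> : 2 * alpha * q * (2 * (1 + D * H) * eps) = 4 * alpha * (1 + D * H) * (q * eps).
    by ring.
  apply: ler_piMr; last by apply: le_trans e1; exact: le_trans qux Eae.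
  by apply: mulr_ge0; clear -alpha0 DH; lra.
rewrite uz; apply: le_trans (slide_tracking theta _ _ z0) _; rewrite -/c.
have Bb : `|(t - t1) * W - (t - t0) * (D * c)| <= (2 * T * C1 + D * H) * e.
  have -> : (t - t1) * W - (t - t0) * (D * c) = (t - t1) * (W - D * c) - (t1 - t0) * (D * c).
    by ring.
  rewrite (le_trans (ler_normB _ _))// [leRHS]mulrDl lerD//.
    rewrite normrM gtr0_norm ?subr_gt0//.
    have -> : 2 * T * C1 * e = T * (2 * (C1 * e)) by ring.
    apply: ler_pM => //; first by rewrite subr_ge0 ltW.
    by clear -t00 t01 tT; lra.
  have [g0 g1] := time_gap t1 (ltW t01) (lexx _).
  by rewrite ger0_norm.
by apply: (le_trans (lerD zZ Bb)); clear -Ca' Cb'; lra.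
Qed.

(** [tracking_error] with [e] of order [1 / sqrt k]; the threshold on [k] makes
    [e] small enough for the crossing. *)
Lemma convergence_rate (R : realType) (theta alpha x2_0 dx1 D T : R) :
  0 < theta -> theta < pi / 2 -> 1 < alpha -> x2_0 < 0 -> 0 < dx1 -> 0 < D -> 0 <= T ->
  exists C k0 : R, [/\ 0 <= C, 0 < k0 & forall k u, k0 <= k ->
    penalized_solution theta alpha k (vec2 0 x2_0) (vec2 dx1 D) u ->
    forall t, 0 <= t -> t <= T ->
      `|limit_motion theta (vec2 0 x2_0) (vec2 dx1 D) (- x2_0 / D) t - u t|
        <= C / Num.sqrt k].
Proof.
move=> th0 th1 alpha1 x20 dx10 D0 T0.
have s0 := sin_cone_gt0 th0 th1.
have c0 := cos_cone_gt0 th0 th1.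
pose rho := root_gap alpha.
have rho0 : 0 < rho := root_gap_gt0 alpha1.
have rhoa : rho < alpha := root_gap_lt alpha1.
have alpha0 : 0 < alpha := lt_trans ltr01 alpha1.
have r20 : 0 < 2 * rho by rewrite mulr_gt0.
pose kappa := ((alpha - rho) * (- x2_0 / D))^-1.
have kappa0 : 0 < kappa.
  by rewrite invr_gt0 mulr_gt0 ?subr_gt0// divr_gt0// oppr_gt0.
pose Ea := dx1 / (2 * rho) * kappa.
pose Eb := dx1 * (1 + alpha / (2 * rho)) * kappa.
have Ea0 : 0 < Ea by apply: mulr_gt0 => //; exact: divr_gt0.
have Eb0 : 0 < Eb.
  by apply: mulr_gt0 => //; apply: mulr_gt0 => //; apply: addr_gt0 => //; exact: divr_gt0.
pose E := Ea + Eb.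
have E0 : 0 < E by rewrite addr_gt0.
pose H := crossing_rate theta D.
have H0 : 0 < H by rewrite divr_gt0 ?mulr_gt0.
have DH : 0 < D * H by rewrite mulr_gt0.
pose C1 := velocity_drift theta alpha D.
have C10 : 0 < C1.
  have aD : 0 < alpha * D by rewrite mulr_gt0.
  have : 0 < H * (4 * alpha * D + 2 + 2 * D * H).
    by rewrite mulr_gt0//; clear -aD DH; lra.
  by rewrite /C1 /velocity_drift -/H; clear; lra.
have CE : 0 < 8 * (C1 * E) by rewrite mulr_gt0// mulr_gt0.
pose Lc := 8 * (C1 * E) / (D * cos theta).
pose Ls := 8 * (C1 * E) / (D * sin theta).
have Lc0 : 0 < Lc by apply: divr_gt0 => //; exact: mulr_gt0.
have Ls0 : 0 < Ls by apply: divr_gt0 => //; exact: mulr_gt0.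
pose L := 1 + E + Lc + Ls.
pose Z := 2 * D + 4 * alpha * (1 + D * H).
have Z0 : 0 < Z.
  have : 0 < alpha * (D * H) by rewrite mulr_gt0.
  by rewrite /Z; clear -D0 alpha0; lra.
have F0 : 0 < (2 + 3 * (D * H)) * E by rewrite mulr_gt0//; clear -DH; lra.
have G0 : 0 < (2 * T * C1 + D * H) * E.
  rewrite mulr_gt0//; have : 0 <= T * C1 by rewrite mulr_ge0// ltW.
  by clear -DH; lra.
exists (dx1 / (2 * rho) + (2 + 3 * (D * H)) * E + Z / (2 * rho) +
  (2 * T * C1 + D * H) * E), (L ^+ 2).
have L1 : 1 <= L by rewrite /L; clear -E0 Lc0 Ls0; lra.
have L0 : 0 < L := lt_le_trans ltr01 L1.
split; first by rewrite !addr_ge0 ?(ltW F0) ?(ltW G0)// divr_ge0// ltW.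
  by rewrite exprn_gt0.
move=> k u0 kL /penalized_motion[u [v [mo uE u00 v00]]] t tt tT.
rewrite -uE// {uE u0}.
have k0 : 0 < k by apply: lt_le_trans kL; rewrite exprn_gt0.
pose q := Num.sqrt k.
have qL : L <= q by rewrite -(ger0_norm (ltW L0)) -sqrtr_sqr /q ler_sqrt ?(ltW k0).
have q0 : 0 < q := lt_le_trans L0 qL.
have k1 : 1 <= k by apply: le_trans kL; rewrite exprn_ege1.
have [Eq Lcq Lsq] : [/\ E <= q, Lc <= q & Ls <= q].
  by rewrite /L in qL; clear -qL E0 Lc0 Ls0; split; lra.
have drift w : 0 < w -> 8 * (C1 * E) / w <= q -> C1 * (E / q) <= w / 8.
  move=> w0; rewrite ler_pdivrMr// => H1.
  by rewrite mulrA ler_pdivrMr//; clear -H1; lra.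
have := @tracking_error R theta alpha k x2_0 dx1 D T (E / q) u v mo u00 v00 th0 th1
  alpha1 x20 dx10 D0 k1 (divr_gt0 E0 q0).
rewrite -/rho -/kappa -/H -/C1 -/q -/Z => track.
have -> : (dx1 / (2 * rho) + (2 + 3 * (D * H)) * E + Z / (2 * rho) +
    (2 * T * C1 + D * H) * E) / Num.sqrt k =
  dx1 / (2 * rho * q) + (2 + 3 * (D * H)) * (E / q) + Z / (2 * rho * q) +
    (2 * T * C1 + D * H) * (E / q).
  by rewrite -/q; field; rewrite !gt_eqF.
apply: track => //.
- by rewrite ler_pdivrMr// mul1r.
- by apply: drift => //; exact: mulr_gt0.
- by apply: drift => //; exact: mulr_gt0.
- by rewrite mulrA ler_pM2r ?invr_gt0// lerDl ltW.
- by rewrite mulrA ler_pM2r ?invr_gt0// lerDr ltW.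
Qed.

Theorem theorem4p2 (R : realType) (theta alpha x2_0 dx1_0 dx2_0 : R)
    (u : R -> R -> 'rV[R]_2) :
  0 < theta -> theta < pi / 2 ->
  1 < alpha ->
  x2_0 < 0 -> 0 < dx1_0 -> 0 < dx2_0 ->
  (forall k : R, 0 < k ->
     penalized_solution theta alpha k (vec2 0 x2_0) (vec2 dx1_0 dx2_0) (u k)) ->
  forall A : set R, compact A -> A `<=` `[0, +oo[ ->
    {uniform A, u k @[k --> +oo] -->
       limit_motion theta (vec2 0 x2_0) (vec2 dx1_0 dx2_0) (- x2_0 / dx2_0)}.
Proof.
move=> th0 th1 alpha1 x20 dx10 D0 sol A cA Apos.
have [M [_ HM]] := compact_bounded cA.
pose T := Num.max M 0 + 1.
have T0 : 0 <= T by rewrite addr_ge0// le_max lexx orbT.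
have AT t : A t -> 0 <= t <= T.
  move=> At; have := Apos t At; rewrite /= in_itv/= andbT => t0; rewrite t0/=.
  have MT : M < T by rewrite /T ltr_pwDr// le_max lexx.
  by apply: le_trans (HM T MT t At); exact: ler_norm.
have [C [k0 [C0 k00 rate]]] := convergence_rate th0 th1 alpha1 x20 dx10 D0 T0.
move=> P /uniform_nbhs[E [entE EP]].
move: entE; rewrite -entourage_ballE => -[e /= e0 eE].
exists (Num.max k0 ((C / e + 1) ^+ 2)); split; first exact: num_real.
move=> k; rewrite gt_max => /andP[k0k Ck].
have k_gt0 : 0 < k := lt_trans k00 k0k.
apply: EP => t /= At.
have /andP[t_ge0 tT] := AT t At.
apply: eE => /=; rewrite -ball_normE/=.
apply: le_lt_trans (rate k (u k) (ltW k0k) (sol k k_gt0) t t_ge0 tT) _.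
have Ce : 0 <= C / e by rewrite divr_ge0// ltW.
have Cq : C / e + 1 < Num.sqrt k.
  by rewrite -[ltLHS]ger0_norm ?addr_ge0// -sqrtr_sqr ltr_sqrt.
have q0 : 0 < Num.sqrt k by apply: le_lt_trans Cq; rewrite addr_ge0.
rewrite ltr_pdivrMr// mulrC -ltr_pdivrMr//.
by apply: lt_trans Cq; rewrite ltrDl.
Qed.
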